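(* Let $\Lambda$ be a finite dimensional algebra over an algebraically closed field $k$. Let $\mathcal{P}^1(\Lambda)=\{M\in\operatorname{mod}\Lambda \mid \operatorname{pd}_{\Lambda}M\leq 1\}$. Then $\Lambda$ is an Auslander algebra if and only if there exists a hereditary torsion pair $(\mathcal{T},\mathcal{F})$ in $\operatorname{mod}\Lambda$ such that $\mathcal{P}^1(\Lambda)=\mathcal{F}$ and, if $I$ is any indecomposable injective $\Lambda$-module, then $\operatorname{pd}_{\Lambda}I\neq 1$.
   Context: All algebras are finite dimensional over an algebraically closed field $k$; $\operatorname{mod}\Lambda$ is the category of finitely generated right $\Lambda$-modules; $\operatorname{pd}_\Lambda M$ is the projective dimension of $M$ in $\operatorname{mod}\Lambda$; subcategories are full and closed under isomorphism. Auslander algebra: if $B$ is an algebra of finite representation type and $M_1,\dots,M_n$ is a complete set of representatives of the isomorphism classes of indecomposable $B$-modules, then $\operatorname{End}_B(\bigoplus_{i=1}^n M_i)$ is the Auslander algebra of $B$. An algebra is called an Auslander algebra if it arises in this way, up to Morita equivalence; by Auslander's characterization these are exactly the algebras $\Lambda$ with global dimension at most $2$ and dominant dimension at least $2$. Here, if $0\to\Lambda_\Lambda\to I_0\to I_1\to I_2\to\cdots$ is a minimal injective resolution, the dominant dimension of $\Lambda$ is $n$ if $I_i$ is projective for $0\le i\le n-1$ and $I_n$ is not projective, and is $\infty$ if all $I_n$ are projective. Torsion pair: a pair $(\mathcal{T},\mathcal{F})$ of full subcategories of $\operatorname{mod}\Lambda$ such that (1) $\operatorname{Hom}_\Lambda(M,N)=0$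 for all $M\in\mathcal{T}$, $N\in\mathcal{F}$; (2) if $\operatorname{Hom}_\Lambda(M,N)=0$ for all $N\in\mathcal{F}$, then $M\in\mathcal{T}$; (3) if $\operatorname{Hom}_\Lambda(M,N)=0$ for all $M\in\mathcal{T}$, then $N\in\mathcal{F}$. A torsion pair $(\mathcal{T},\mathcal{F})$ is hereditary if $\mathcal{T}$ is closed under submodules (equivalently, $\mathcal{F}$ is closed under injective envelopes). *)

(* Defs.v *)
From HB Require Import structures.
From mathcomp Require Import all_boot all_order all_algebra all_field.
Set Implicit Arguments.
Unset Strict Implicit.
Unset Printing Implicit Defensive.
Import GRing.Theory.
Local Open Scope ring_scope.

Section Modules.
Variable R : nzRingType.

Definition finitely_generated (M : lmodType R) : Prop :=
  exists (n : nat) (g : 'I_n -> M),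
    forall x : M, exists c : 'I_n -> R, x = \sum_(i < n) c i *: g i.

Record fgmod := FGMod {
  fgmod_sort :> lmodType R;
  fgmodP : finitely_generated fgmod_sort }.

Definition surj (A B : Type) (f : A -> B) : Prop := forall y, exists x, f x = y.

Definition zero_mod (M : lmodType R) : Prop := forall x : M, x = 0.

Definition isomorphic (M N : lmodType R) : Prop :=
  exists f : {linear M -> N}, bijective f.

Definition indecomposable (M : fgmod) : Prop :=
  ~ zero_mod M /\
  forall X Y : fgmod,
    isomorphic M (X * Y)%type -> zero_mod X \/ zero_mod Y.

Definition projective (P : fgmod) : Prop :=
  forall (X Y : fgmod) (g : {linear X -> Y}) (f : {linear P -> Y}),
    surj g -> exists h : {linear P -> X}, forall x, g (h x) = f x.

Definition injective_mod (I : fgmod) : Prop :=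
  forall (X Y : fgmod) (g : {linear X -> Y}) (f : {linear X -> I}),
    injective g -> exists h : {linear Y -> I}, forall x, h (g x) = f x.

Definition exact_at (X Y Z : lmodType R) (f : X -> Y) (g : Y -> Z) : Prop :=
  forall y, g y = 0 <-> exists x, f x = y.

(* ... -> P 2 -> P 1 -> P 0 -> M -> 0 exact with all P i projective *)
Definition projective_resolution (M : fgmod) (P : nat -> fgmod)
    (d : forall i, {linear P i.+1 -> P i}) (e : {linear P 0%N -> M}) : Prop :=
  [/\ forall i, projective (P i),
      surj e,
      exact_at (d 0%N) e
    & forall i, exact_at (d i.+1) (d i)].

Definition pd_le (M : fgmod) (n : nat) : Prop :=
  exists (P : nat -> fgmod) (d : forall i, {linear P i.+1 -> P i})
         (e : {linear P 0%N -> M}),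
    projective_resolution d e /\ forall i, (n < i)%N -> zero_mod (P i).

Definition pd_eq (M : fgmod) (n : nat) : Prop :=
  pd_le M n /\ forall m, (m < n)%N -> ~ pd_le M m.

Definition hom_zero (M N : fgmod) : Prop :=
  forall (f : {linear M -> N}) x, f x = 0.

Definition iso_closed (C : fgmod -> Prop) : Prop :=
  forall M N : fgmod, isomorphic M N -> C M -> C N.

Record torsion_pair (T F : fgmod -> Prop) : Prop := {
  torsion_iso : iso_closed T;
  torsionfree_iso : iso_closed F;
  torsion_hom : forall M N, T M -> F N -> hom_zero M N;
  torsion_max : forall M, (forall N, F N -> hom_zero M N) -> T M;
  torsionfree_max : forall N, (forall M, T M -> hom_zero M N) -> F N }.

Definition closed_under_submodules (C : fgmod -> Prop) : Prop :=
  forall (M N : fgmod) (i : {linear N -> M}), injective i -> C M -> C N.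

Definition hereditary_torsion_pair (T F : fgmod -> Prop) : Prop :=
  torsion_pair T F /\ closed_under_submodules T.

Definition direct_sum (n : nat) (M : 'I_n -> fgmod) (S : fgmod) : Prop :=
  exists (inj : forall i, {linear M i -> S})
         (proj : forall i, {linear S -> M i}),
    [/\ forall i x, proj i (inj i x) = x,
        forall i j x, i != j -> proj j (inj i x) = 0
      & forall s, s = \sum_(i < n) inj i (proj i s)].

Definition complete_indecomposables (n : nat) (M : 'I_n -> fgmod) : Prop :=
  [/\ forall i, indecomposable (M i),
      forall i j, isomorphic (M i) (M j) -> i = j
    & forall X : fgmod, indecomposable X -> exists i, isomorphic X (M i)].

End Modules.

Section Algebras.
Variable k : closedFieldType.

(* A right module over L is a left module over the converse ring L^c:
   the right action m . a is (a : L^c) *: m. *)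
Definition rmod (L : falgType k) := fgmod L^c.

Definition kscale (L : falgType k) (M : rmod L) (c : k) (m : M) : M :=
  ((c%:A : L) : L^c) *: m.

(* A is isomorphic, as a k-algebra, to End_B(S) with composition as product. *)
Definition endomorphism_algebra (A B : falgType k) (S : rmod B) : Prop :=
  exists phi : A -> {linear S -> S},
    [/\ forall s, phi 1 s = s,
        forall a b s, phi (a * b) s = phi a (phi b s),
        forall c a b s, phi (c *: a + b) s = kscale c (phi a s) + phi b s,
        forall a b, phi a =1 phi b -> a = b
      & forall f : {linear S -> S}, exists a, phi a =1 f].

Definition Auslander_algebra_of (A B : falgType k) : Prop :=
  exists (n : nat) (M : 'I_n -> rmod B) (S : rmod B),
    [/\ complete_indecomposables M, direct_sum M S
      & endomorphism_algebra A S].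

(* Morphisms are compared pointwise, so fmap_linear (with c = 0) also says that
   fmap respects equality of morphisms. *)
Record klinear_functor (A B : falgType k) := KLinearFunctor {
  fobj :> rmod A -> rmod B;
  fmap : forall M N : rmod A, {linear M -> N} -> {linear fobj M -> fobj N};
  fmap_id : forall (M : rmod A) (f : {linear M -> M}),
    f =1 id -> fmap f =1 id;
  fmap_comp : forall (M N Q : rmod A) (f : {linear M -> N})
      (g : {linear N -> Q}) (h : {linear M -> Q}),
    h =1 g \o f -> fmap h =1 fmap g \o fmap f;
  fmap_linear : forall (M N : rmod A) (c : k) (f g h : {linear M -> N}),
    (forall x, h x = kscale c (f x) + g x) ->
    forall y, fmap h y = kscale c (fmap f y) + fmap g y }.

Definition Morita_equivalent (A B : falgType k) : Prop :=
  exists (F : klinear_functor A B) (G : klinear_functor B A)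
         (eta : forall M : rmod A, {linear M -> G (F M)})
         (eps : forall N : rmod B, {linear F (G N) -> N}),
    [/\ forall M, bijective (eta M),
        forall (M N : rmod A) (f : {linear M -> N}) x,
          eta N (f x) = fmap G (fmap F f) (eta M x),
        forall N, bijective (eps N)
      & forall (M N : rmod B) (f : {linear M -> N}) y,
          f (eps M y) = eps N (fmap F (fmap G f) y)].

Definition Auslander_algebra (L : falgType k) : Prop :=
  exists B A : falgType k, Auslander_algebra_of A B /\ Morita_equivalent L A.

End Algebras.

(* Main.v *)
Require Import Defs.
From HB Require Import structures.
From mathcomp Require Import all_boot all_order all_algebra all_field.
From mathcomp Require Import boolp.
Set Implicit Arguments.
Unset Strict Implicit.
Unset Printing Implicit Defensive.
Import GRing.Theory.
Local Open Scope ring_scope.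

(** The two sides of the equivalence meet in the following condition on
    Lambda: there are an algebra B and a B-module S with End_B(S) = Lambda
    such that every B-module is a direct summand of a power of S.

    This condition says that Lambda is an Auslander algebra up to Morita
    equivalence.  Given S, let M_1, ..., M_n be the distinct indecomposable
    summands of S.  By the Krull-Schmidt argument (indec_summand) they are all
    the indecomposable B-modules, and S and U = M_1 + ... + M_n are summands of
    powers of each other.  Hence P = Hom_B(S, U) is a progenerator of mod Lambda
    with endomorphism algebra End_B(U), and Hom_Lambda(P, -) is an equivalence
    (Auslander_algebra_of_generator, Morita_progenerator).  Conversely, an
    equivalence F from mod Lambda to mod A with A = End_B(M_1 + ... + M_n) sends
    Lambda to a progenerator of mod A, which has the form
    Hom_B(M_1 + ... + M_n, S) for some S; this is the S that is wanted
    (generator_of_Auslander_algebra).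

    Given such an S, the functor h = Hom_B(S, -) is fully faithful, preserves
    kernels, and its essential image consists of the projective Lambda-modules.
    It sends injective modules to injective modules, so Q = h(D B) is both
    projective and injective.  An injective module Q always defines a hereditary
    torsion pair, whose torsion modules N are those with Hom(N, Q) = 0 and whose
    torsion-free modules are those cogenerated by Q; here the torsion-free
    modules are exactly those of projective dimension at most 1.  If
    0 -> h X_1 -> h X_0 -> M -> 0 is exact, then M embeds into h(X_0 / X_1), which
    is cogenerated by Q; if M is cogenerated by Q and h X_0 -> M is onto, then its
    kernel is cut out by maps h X_0 -> Q, that is by maps X_0 -> D B, so it is
    h of a submodule of X_0.  An injective module of projective dimension at most
    1 embeds into some projective h Y, splits off, and is projective
    (generator_torsion_pair).

    Let conversely (T, F) be as in the statement.  Since T is closed under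
    submodules, F is closed under injective envelopes; an injective module in F
    has indecomposable summands of projective dimension at most 1, hence
    projective.  So each torsion-free module embeds into a projective-injective
    one.  Apply this to Lambda and then to I_0 / Lambda, which has projective
    dimension at most 1: there is an exact sequence 0 -> Lambda -> I_0 -> I_1 with
    I_0 and I_1 projective-injective.  Put Q = I_0 + I_1, B = End_Lambda(Q) and
    S = D Q, a right B-module.  The exact sequence gives the double centralizer
    property End_B(D Q) = Lambda (double_centralizer).  Finally, a B-module X is
    described by linear relations over B on its dual D X; the solutions in powers
    of Q of these relations form a Lambda-module P.  It is the kernel of a map
    from a projective module Q^n to a power of Q; the image of that map is
    torsion-free, hence of projective dimension at most 1, so P is projective.
    And X is isomorphic to D Hom_Lambda(P, Q), a summand of a power of
    D Hom_Lambda(Lambda, Q) = S (dual_generates). *)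

(** * Linear maps *)

Section LinearMaps.
Variable R : nzRingType.

Definition linear_of (M N : lmodType R) (f : M -> N) (lin_f : linear f) :
    {linear M -> N} :=
  HB.pack f (GRing.isLinear.Build R M N *:%R f lin_f).

Lemma linear_ofE (M N : lmodType R) (f : M -> N) (lin_f : linear f) :
  linear_of lin_f =1 f.
Proof. by []. Qed.

Lemma comp_linE (M N K : lmodType R) (f : {linear N -> K})
  (g : {linear M -> N}) x : (f \o g : {linear M -> K}) x = f (g x).
Proof. by []. Qed.

Lemma inj0P (M N : lmodType R) (f : {linear M -> N}) :
  injective f <-> (forall x, f x = 0 -> x = 0).
Proof.
split=> [f_inj x fx0|f0 x y /eqP]; first by apply: f_inj; rewrite fx0 linear0.
by rewrite -subr_eq0 -linearB => /eqP/f0/eqP; rewrite subr_eq0 => /eqP.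
Qed.

Lemma inv_linear (M N : lmodType R) (f : {linear M -> N}) :
  bijective f -> exists g : {linear N -> M}, cancel f g /\ cancel g f.
Proof.
case=> g fK gK.
have lin_g : linear g by move=> a x y; apply: (can_inj fK); rewrite linearP !gK.
by exists (linear_of lin_g).
Qed.

Lemma factor_inj (N M X : lmodType R) (i : {linear N -> M})
    (f : {linear X -> M}) :
  injective i -> (forall x, exists y, i y = f x) ->
  exists g : {linear X -> N}, forall x, i (g x) = f x.
Proof.
move=> i_inj /choice[g gE].
have lin_g : linear g by move=> a x y; apply: i_inj; rewrite linearP !gE linearP.
by exists (linear_of lin_g).
Qed.

Lemma factor_surj (M N X : lmodType R) (p : {linear M -> N})
    (f : {linear M -> X}) :
  surj p -> (forall x, p x = 0 -> f x = 0) ->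
  exists g : {linear N -> X}, forall x, g (p x) = f x.
Proof.
move=> /choice[s sE] pf.
have gE x : f (s (p x)) = f x.
  by apply/eqP; rewrite -subr_eq0 -linearB; apply/eqP/pf; rewrite linearB /= sE subrr.
have lin_g : linear (f \o s).
  by move=> a x y /=; rewrite -{1}(sE x) -{1}(sE y) -linearP gE linearP.
by exists (linear_of lin_g).
Qed.

Lemma bijectiveP (M N : lmodType R) (f : {linear M -> N}) :
  injective f -> surj f -> bijective f.
Proof. by move=> f_inj /choice[g gE]; exists g => // x; apply: f_inj. Qed.

Lemma bij_surj (A C : Type) (f : A -> C) : bijective f -> surj f.
Proof. by case=> g _ gK y; exists (g y). Qed.

Lemma isomorphic_sym (M N : lmodType R) : isomorphic M N -> isomorphic N M.
Proof.
by case=> f /inv_linear[g [fK gK]]; exists g; exists f.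
Qed.

Lemma isomorphic_trans (M N K : lmodType R) :
  isomorphic M N -> isomorphic N K -> isomorphic M K.
Proof. by case=> f f_bij [g g_bij]; exists (g \o f : {linear M -> K}); exact: bij_comp. Qed.

Lemma isomorphic_refl (M : lmodType R) : isomorphic M M.
Proof. by exists (idfun : {linear M -> M}); exists id. Qed.

Lemma fg_finType (I : finType) (M : lmodType R) (g : I -> M) :
  (forall x, exists c : I -> R, x = \sum_i c i *: g i) -> finitely_generated M.
Proof.
move=> gP; exists #|I|, (g \o enum_val) => x; have [c ->] := gP x.
by exists (c \o enum_val); rewrite (big_enum_val (fun i => c i *: g i)).
Qed.

Lemma fg_pair (M N : lmodType R) :
  finitely_generated M -> finitely_generated N ->
  finitely_generated (M * N)%type.
Proof.
move=> [m [g gP]] [n [h hP]].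
apply: (@fg_finType ('I_m + 'I_n)%type _ (fun i =>
  match i with inl i => (g i, 0) | inr i => (0, h i) end)) => -[x y].
have [c xE] := gP x; have [d yE] := hP y.
exists (fun i => match i with inl i => c i | inr i => d i end).
have fstL : linear (@fst M N) by [].
have sndL : linear (@snd M N) by [].
rewrite big_sumType /=; apply: injective_projections.
  rewrite -!(linear_ofE fstL) linearD !linear_sum /= [X in _ + X]big1 ?addr0 //= => i _.
  by rewrite scaler0.
rewrite -!(linear_ofE sndL) linearD !linear_sum /= big1 ?add0r //= => i _.
by rewrite scaler0.
Qed.

End LinearMaps.

(** * The vector space underlying a module *)

(** A generating family of least cardinality is a basis: a relation with a
    nonzero coefficient would allow one generator to be dropped. *)
Lemma fg_vector_axiom (k : fieldType) (V : lmodType k) :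
  finitely_generated V -> exists n, inhabited (vector_axiom_def n V).
Proof.
move=> fgV.
pose P n := `[< exists g : 'I_n -> V, forall x, exists c : 'I_n -> k,
  x = \sum_(i < n) c i *: g i >].
have exP : exists n, P n by have [n gP] := fgV; exists n; apply/asboolP.
case: (ex_minnP exP) => n /asboolP[g gP] n_min; exists n.
pose s (c : 'rV[k]_n) := \sum_(i < n) c 0 i *: g i.
have lin_s : linear s.
  move=> a c d; rewrite /s scaler_sumr -big_split /=; apply: eq_bigr => i _.
  by rewrite !mxE scalerDl scalerA.
have s_surj : surj s.
  move=> x; have [c ->] := gP x; exists (\row_i c i).
  by apply: eq_bigr => i _; rewrite mxE.
have s_inj : injective (linear_of lin_s).
  apply/inj0P => c /= sc0; apply/rowP => j; rewrite mxE; apply/eqP/negPn/negP => cj0.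
  case: n => [|n] in g gP n_min s lin_s s_surj c sc0 j cj0 *; first by case: j cj0.
  have: (n.+1 <= n)%N; last by rewrite ltnn.
  apply: n_min; apply/asboolP; exists (g \o lift j) => x.
  have [d ->] := gP x.
  have gj : g j = \sum_(i < n) - (c 0 j)^-1 * c 0 (lift j i) *: g (lift j i).
    apply: (scalerI cj0); move/eqP: sc0.
    rewrite /s (bigD1_ord j) //= addr_eq0 => /eqP ->.
    rewrite scaler_sumr -sumrN; apply: eq_bigr => i _.
    by rewrite scalerA mulNr mulrN mulVKf // scaleNr.
  exists (fun i => d j * (- (c 0 j)^-1 * c 0 (lift j i)) + d (lift j i)).
  rewrite (bigD1_ord j) //= {1}gj scaler_sumr -big_split /=.
  by apply: eq_bigr => i _; rewrite scalerA scalerDl.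
have [r [rK sK]] := inv_linear (bijectiveP s_inj s_surj).
split; exists r; first by move=> a x y; rewrite linearP.
by exists s.
Qed.

Section KSpace.
Variables (k : closedFieldType) (L : falgType k).

(** A copy of the carrier of M on which the base field acts, so that subspaces,
    dimensions and linear maps over k are available next to the action of L. *)
Definition kspace (M : rmod L) : Type := fgmod_sort M.

Section Instances.
Variable M : rmod L.
HB.instance Definition _ := GRing.Zmodule.copy (kspace M) (fgmod_sort M).

Fact kscaleA (a b : k) (x : kspace M) : kscale a (kscale b x) = kscale (a * b) x.
Proof.
rewrite /kscale scalerA; congr (_ *: _).
by rewrite -[LHS]/(b%:A * a%:A : L) mulr_algl scalerA mulrC.
Qed.
Fact kscale1 : left_id 1 (@kscale k L M).
Proof. by move=> x; rewrite /kscale !scale1r. Qed.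
Fact kscaleDr : right_distributive (@kscale k L M) +%R.
Proof. by move=> a x y; rewrite /kscale scalerDr. Qed.
Fact kscaleDl (x : kspace M) : {morph (@kscale k L M)^~ x : a b / a + b}.
Proof. by move=> a b; rewrite /kscale -scalerDl -[in RHS]scalerDl. Qed.

HB.instance Definition _ := GRing.Zmodule_isLmodule.Build k (kspace M)
  kscaleA kscale1 kscaleDr kscaleDl.

Lemma kspaceZ (c : k) (x : kspace M) : c *: x = kscale c (x : M).
Proof. by []. Qed.

Lemma kscale_act (c : k) (a : L) (x : M) :
  kscale c ((a : L^c) *: x) = ((c *: a : L) : L^c) *: x.
Proof.
rewrite /kscale scalerA; congr (_ *: _).
by rewrite -[LHS]/(a * c%:A : L) mulr_algr.
Qed.

Lemma act_kscale (c : k) (a : L) (x : M) :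
  (a : L^c) *: kscale c x = kscale c ((a : L^c) *: x).
Proof.
rewrite kscale_act /kscale scalerA; congr (_ *: _).
by rewrite -[LHS]/(c%:A * a : L) mulr_algl.
Qed.

Lemma kspace_fg : finitely_generated (kspace M : lmodType k).
Proof.
have [n [g gP]] := fgmodP M.
pose e := vbasis {:L}.
apply: (@fg_finType k _ (kspace M) (fun p : 'I_n * 'I_(\dim {:L}) =>
  (e`_p.2 : L^c) *: g p.1)) => x.
have [c ->] := gP x; exists (fun p => coord e p.2 (c p.1 : L)).
rewrite -(pair_bigA _ (fun i j => coord e j (c i : L) *: ((e`_j : L^c) *: g i : kspace M))) /=.
apply: eq_bigr => i _.
rewrite {1}[c i](coord_vbasis (memvf (c i : L))) scaler_suml; apply: eq_bigr => j _.
by rewrite kspaceZ kscale_act.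
Qed.

Definition kspace_dim := projT1 (cid (fg_vector_axiom kspace_fg)).
Definition kspace_axiom : vector_axiom_def kspace_dim (kspace M : lmodType k).
Proof.
rewrite /kspace_dim; case: (cid _) => n /= H.
have : exists _ : vector_axiom_def n (kspace M : lmodType k), True by case: H => H; exists H.
by case/cid.
Qed.
HB.instance Definition _ := Lmodule_hasFinDim.Build k (kspace M) kspace_axiom.
End Instances.
End KSpace.

Lemma vect_fg (k : fieldType) (V : vectType k) : finitely_generated V.
Proof.
exists (\dim {:V}), (fun i => (vbasis {:V})`_i) => x.
by exists (fun i => coord (vbasis {:V}) i x); apply/coord_vbasis/memvf.
Qed.

(** A subspace of largest dimension among those contained in P must be P. *)
Lemma vspace_of (k : fieldType) (V : vectType k) (P : V -> Prop) :
  P 0 -> (forall a x y, P x -> P y -> P (a *: x + y)) ->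
  exists U : {vspace V}, forall x, x \in U <-> P x.
Proof.
move=> P0 PD.
pose D n := `[< exists U : {vspace V}, \dim U = n /\ forall x, x \in U -> P x >].
have exD : exists n, D n.
  exists 0%N; apply/asboolP; exists 0%VS; split; first exact: dimv0.
  by move=> x; rewrite memv0 => /eqP ->.
have maxD n : D n -> (n <= \dim {:V})%N.
  by move=> /asboolP[U [<- _]]; apply/dimvS/subvf.
case: (ex_maxnP exD maxD) => n /asboolP[U [dimU UP]] n_max; exists U => x; split; first exact: UP.
move=> Px; apply/negPn/negP => xU.
have: (\dim (U + <[x]>) <= n)%N.
  apply: n_max; apply/asboolP; exists (U + <[x]>)%VS; split=> // w.
  move=> /memv_addP[u uU [v /vlineP[a ->] ->]].
  by rewrite addrC; apply: PD => //; apply: UP.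
apply/negP; rewrite -ltnNge -dimU ltn_neqAle dimvS ?addvSl // andbT.
have := dimv_leqif_eq (addvSl U <[x]>); move=> /geq_leqif ge.
rewrite eq_sym; apply: contra xU => /eqP dimE.
have := dimv_leqif_eq (addvSl U <[x]>); rewrite dimE => /leqif_refl /eqP ->.
by rewrite memvE addvSr.
Qed.

(** * Modules from actions, submodules and quotients *)

Section Actions.
Variables (k : closedFieldType) (L : falgType k).

(** Every module constructed below is a vector space over k together with such
    an action; finite generation over L then comes for free. *)
Record right_action (V : vectType k) := RightAction {
  ract :> V -> L -> V;
  ract_linearl : forall a, linear (ract^~ a);
  ract_linearr : forall v, linear (ract v);
  ract1 : forall v, ract v 1 = v;
  ractM : forall v a b, ract v (a * b) = ract (ract v a) b }.

Definition action_module_type (V : vectType k) (r : right_action V) : Type := V.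

Section Instances.
Variables (V : vectType k) (r : right_action V).
HB.instance Definition _ := GRing.Zmodule.copy (action_module_type r) V.

Definition action_module_scale (a : L^c) (v : action_module_type r) :
  action_module_type r := r v a.

Fact action_module_scaleA a b v :
  action_module_scale a (action_module_scale b v) = action_module_scale (a * b) v.
Proof. by rewrite /action_module_scale [a * b](_ : _ = (b : L) * (a : L)) // ractM. Qed.
Fact action_module_scale1 : left_id 1 action_module_scale.
Proof. exact: ract1. Qed.
Fact action_module_scaleDr : right_distributive action_module_scale +%R.
Proof. by move=> a x y; have := ract_linearl r a 1 x y; rewrite !scale1r. Qed.
Fact action_module_scaleDl v : {morph action_module_scale^~ v : a b / a + b}.
Proof. by move=> a b; have := ract_linearr r v 1 a b; rewrite !scale1r. Qed.

HB.instance Definition _ := GRing.Zmodule_isLmodule.Build L^c (action_module_type r)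
  action_module_scaleA action_module_scale1 action_module_scaleDr action_module_scaleDl.

Lemma ract_alg (v : V) (c : k) : r v c%:A = c *: v.
Proof.
by rewrite -[LHS]/(linear_of (ract_linearr r v) _) linearZ /= ract1.
Qed.

Lemma action_module_fg : finitely_generated (action_module_type r : lmodType L^c).
Proof.
have [n [g gP]] := vect_fg V; exists n, g => x; have [c xE] := gP x.
exists (fun i => (c i)%:A : L); rewrite {1}xE; apply: eq_bigr => i _.
by rewrite -ract_alg.
Qed.

Definition action_module : rmod L := FGMod action_module_fg.

Lemma action_moduleE (a : L) (v : V) : (a : L^c) *: (v : action_module) = r v a.
Proof. by []. Qed.

Lemma action_module_kscale (c : k) (v : V) : kscale c (v : action_module) = c *: v.
Proof. by rewrite /kscale action_moduleE ract_alg. Qed.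

End Instances.

Definition submodule (M : rmod L) (P : M -> Prop) : Prop :=
  P 0 /\ forall (a : L^c) x y, P x -> P y -> P (a *: x + y).

Lemma act_linearl (M : rmod L) (a : L) :
  linear (fun x : kspace M => ((a : L^c) *: (x : M) : kspace M)).
Proof.
move=> c x y; rewrite scalerDr; congr (_ + _).
exact: act_kscale.
Qed.

Lemma act_linearr (M : rmod L) (x : M) :
  linear (fun a : L => ((a : L^c) *: (x : M) : kspace M)).
Proof. by move=> c a b; rewrite scalerDl kspaceZ kscale_act. Qed.

Section Sub.
Variables (M : rmod L) (U : {vspace kspace M}).
Hypothesis U_stable : forall (a : L^c) x, x \in U -> (a *: (x : M) : kspace M) \in U.

Definition sub_act (u : subvs_of U) (a : L) : subvs_of U :=
  vsproj U ((a : L^c) *: (vsval u : M) : kspace M).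

Lemma sub_actE u a : vsval (sub_act u a) = (a : L^c) *: (vsval u : M) :> M.
Proof. by rewrite /sub_act vsprojK //; apply/U_stable/subvsP. Qed.

Fact sub_act_linearl a : linear (sub_act^~ a).
Proof.
by move=> c x y; apply: subvs_inj; rewrite linearP /= !sub_actE linearP; apply: act_linearl.
Qed.
Fact sub_act_linearr v : linear (sub_act v).
Proof.
by move=> c x y; apply: subvs_inj; rewrite linearP /= !sub_actE; apply: act_linearr.
Qed.
Fact sub_act1 v : sub_act v 1 = v.
Proof. by apply: subvs_inj; rewrite sub_actE scale1r. Qed.
Fact sub_actM v a b : sub_act v (a * b) = sub_act (sub_act v a) b.
Proof. by apply: subvs_inj; rewrite !sub_actE scalerA. Qed.

Definition sub_right_action := RightAction sub_act_linearl sub_act_linearr sub_act1 sub_actM.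

Fact sub_val_linear : linear (fun u : action_module sub_right_action => (vsval (u : subvs_of U) : M)).
Proof. by move=> a x y; rewrite -sub_actE; exact: (linearD (@vsval _ _ U) (sub_act x a) y). Qed.

End Sub.

(** This lemma and quotmodP are the interface to submodules and quotients: only
    the universal properties are used, never the concrete carriers. *)
Lemma submodP (M : rmod L) (P : M -> Prop) : submodule P ->
  exists (N : rmod L) (i : {linear N -> M}),
    injective i /\ forall x, P x <-> exists y, i y = x.
Proof.
case=> P0 PD; have [|a x y|U UP] := @vspace_of k (kspace M) P; first exact: P0.
  exact: PD.
have stab (a : L^c) (x : kspace M) : x \in U -> (a *: (x : M) : kspace M) \in U.
  by move=> /UP Px; apply/UP; have := PD a _ _ Px P0; rewrite addr0.
exists (action_module (sub_right_action stab)), (linear_of (@sub_val_linear M U stab)); split=> [|x].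
  exact: subvs_inj.
split=> [/UP xU|[y <-]]; first by exists (vsproj U (x : kspace M)); exact: (vsprojK xU).
by apply/UP/subvsP.
Qed.

Section Quot.
Variables (M : rmod L) (U : {vspace kspace M}).
Hypothesis U_stable : forall (a : L^c) x, x \in U -> (a *: (x : M) : kspace M) \in U.

(** The quotient by U is carried by a complement of U; x - projv U x is the
    component of x in that complement. *)
Definition quo (x : kspace M) : subvs_of (U^C)%VS := vsproj (U^C) (x - projv U x).

Fact quo_linear : linear quo.
Proof.
move=> a x y; rewrite /quo -linearP; congr (vsproj _ _).
by rewrite linearP scalerBr opprD addrACA.
Qed.

Lemma quo_eq0 x : quo x = 0 <-> x \in U.
Proof.
split=> [/(congr1 vsval)|xU].
  rewrite vsprojK ?memv_projC // linear0 => /eqP; rewrite subr_eq0 => /eqP ->.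
  exact: memv_proj.
by apply: subvs_inj; rewrite vsprojK ?memv_projC // projv_id // subrr.
Qed.

Lemma quoK v : quo (vsval v) = v.
Proof.
apply: subvs_inj; rewrite vsprojK ?memv_projC //.
have : vsval v \in lker (projv U) by rewrite lker_proj subvsP.
by rewrite memv_ker => /eqP ->; rewrite subr0.
Qed.

Definition quo_act (u : subvs_of (U^C)%VS) (a : L) : subvs_of (U^C)%VS :=
  quo ((a : L^c) *: (vsval u : M) : kspace M).

Lemma quo_actE x a : quo_act (quo x) a = quo ((a : L^c) *: (x : M) : kspace M).
Proof.
have qE y : quo y = linear_of quo_linear y by [].
apply/eqP; rewrite -subr_eq0 /quo_act !qE -linearB; apply/eqP/quo_eq0.
rewrite -[X in X \in U](scalerBr (a : L^c) (vsval (quo x) : M) (x : M)).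
apply/U_stable/quo_eq0; rewrite !qE linearB /= quoK; exact: subrr.
Qed.

Fact quo_act_linearl a : linear (quo_act^~ a).
Proof.
by move=> c x y; rewrite /quo_act -quo_linear linearP act_linearl.
Qed.
Fact quo_act_linearr v : linear (quo_act v).
Proof. by move=> c x y; rewrite /quo_act act_linearr quo_linear. Qed.
Fact quo_act1 v : quo_act v 1 = v.
Proof. by rewrite -[v]quoK quo_actE scale1r. Qed.
Fact quo_actM v a b : quo_act v (a * b) = quo_act (quo_act v a) b.
Proof. by rewrite -[v]quoK !quo_actE scalerA. Qed.

Definition quo_right_action := RightAction quo_act_linearl quo_act_linearr quo_act1 quo_actM.

Fact quo_mod_linear : linear (quo : M -> action_module quo_right_action).
Proof.
move=> a x y; have -> : a *: (quo x : action_module quo_right_action) = quo (a *: x : M) by apply: quo_actE.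
by have := quo_linear 1 (a *: x : M) y; rewrite !scale1r.
Qed.

End Quot.

Lemma quotmodP (M : rmod L) (P : M -> Prop) : submodule P ->
  exists (N : rmod L) (p : {linear M -> N}),
    surj p /\ forall x, p x = 0 <-> P x.
Proof.
case=> P0 PD; have [|a x y|U UP] := @vspace_of k (kspace M) P; first exact: P0.
  exact: PD.
have stab (a : L^c) (x : kspace M) : x \in U -> (a *: (x : M) : kspace M) \in U.
  by move=> /UP Px; apply/UP; have := PD a _ _ Px P0; rewrite addr0.
exists (action_module (quo_right_action stab)), (linear_of (@quo_mod_linear M U stab)); split=> [y|x].
  by exists (vsval (y : subvs_of _)); apply: quoK.
by rewrite -UP; apply: quo_eq0.
Qed.

Lemma kernel_submodule (M N : rmod L) (f : {linear M -> N}) :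
  submodule (fun x => f x = 0).
Proof.
split=> [|a x y fx fy]; first by rewrite linear0.
by rewrite linearP fx fy scaler0 addr0.
Qed.

Lemma image_submodule (M N : rmod L) (f : {linear M -> N}) :
  submodule (fun y => exists x, f x = y).
Proof.
split=> [|a _ _ [x <-] [y <-]]; first by exists 0; rewrite linear0.
by exists (a *: x + y); rewrite linearP.
Qed.

End Actions.

(** * Dimension, spaces of homomorphisms and the functor Hom(S, -) *)

Section Hom.
Variables (k : closedFieldType) (L : falgType k).
Implicit Types M N X Y : rmod L.

Lemma linear_kscale M N (f : {linear M -> N}) (c : k) x :
  f (kscale c x) = kscale c (f x).
Proof. exact: linearZ. Qed.

Fact klinear_linear M N (f : {linear M -> N}) : linear (f : kspace M -> kspace N).
Proof. by move=> c x y; rewrite !kspaceZ linearD linear_kscale. Qed.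

Definition klinear M N (f : {linear M -> N}) : 'Hom(kspace M, kspace N) :=
  linfun (linear_of (klinear_linear f)).

Lemma klinearE M N (f : {linear M -> N}) x : klinear f x = f x.
Proof. by rewrite lfunE. Qed.

Definition mdim M : nat := \dim {:kspace M}.

Lemma mdim_inj_surj M N (f : {linear M -> N}) :
  injective f -> (mdim N <= mdim M)%N -> surj f.
Proof.
move=> f_inj le_NM y.
have ker0 : ({:kspace M} :&: lker (klinear f) = 0)%VS.
  apply/eqP; rewrite -subv0; apply/subvP => x; rewrite memv_cap memv_ker klinearE.
  by rewrite memv0 => /andP[_ /eqP fx0]; apply/eqP; have /inj0P := f_inj; apply.
have /eqP limE : (limg (klinear f) == {:kspace N})%VS.
  by rewrite eqEdim subvf limg_dim_eq.
have : (y : kspace N) \in limg (klinear f) by rewrite limE memvf.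
by case/memv_imgP => x _ ->; exists x; rewrite klinearE.
Qed.

Lemma mdim_lt M N (f : {linear M -> N}) :
  injective f -> ~ surj f -> (mdim M < mdim N)%N.
Proof.
move=> f_inj f_nsurj; rewrite ltnNge; apply/negP => /(mdim_inj_surj f_inj).
exact: f_nsurj.
Qed.

Definition commutes M N (g : 'Hom(kspace M, kspace N)) : Prop :=
  forall (a : L^c) (x : M), g (a *: x : M) = a *: (g x : N) :> N.

Lemma homsp_exists M N : exists U : {vspace 'Hom(kspace M, kspace N)},
  forall g, g \in U <-> commutes g.
Proof.
apply: vspace_of => [a x|c g h gL hL a x].
  by rewrite !zero_lfunE; symmetry; apply: scaler0.
rewrite !add_lfunE !scale_lfunE gL hL scalerDr; congr (_ + _).
by rewrite !kspaceZ act_kscale.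
Qed.

(** The subspace is chosen from a proof of its existence; homspP determines it. *)
Definition homsp M N := projT1 (cid (homsp_exists M N)).

Lemma homspP M N g : g \in homsp M N <-> commutes g.
Proof. by rewrite /homsp; case: cid => /= U; apply. Qed.

Definition homspace M N : vectType k := subvs_of (homsp M N).

Fact hom_fun_linear M N (h : homspace M N) : linear (vsval h : M -> N).
Proof.
move=> a x y; have /homspP hL := subvsP h.
by rewrite -hL; exact: (linearD (vsval h) (a *: x : M) y).
Qed.

Definition hom_fun M N (h : homspace M N) : {linear M -> N} := linear_of (hom_fun_linear h).

Definition hom_mk M N (f : {linear M -> N}) : homspace M N := vsproj (homsp M N) (klinear f).

Lemma hom_mkE M N (f : {linear M -> N}) x : hom_fun (hom_mk f) x = f x.
Proof.
rewrite /= vsprojK; first exact: klinearE.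
by apply/homspP => a y; rewrite !klinearE linearZ.
Qed.

Lemma hom_eq M N (g h : homspace M N) : (forall x, hom_fun g x = hom_fun h x) -> g = h.
Proof. by move=> gh; apply/subvs_inj/lfunP => x; apply: gh. Qed.

Lemma hom_funP M N (c : k) (g h : homspace M N) x :
  hom_fun (c *: g + h) x = kscale c (hom_fun g x) + hom_fun h x.
Proof.
rewrite -[LHS]/((c *: vsval g + vsval h : 'Hom(kspace M, kspace N)) x).
by rewrite add_lfunE scale_lfunE.
Qed.

Lemma hom_funK M N (h : homspace M N) : hom_mk (hom_fun h) = h.
Proof. by apply: hom_eq => x; rewrite hom_mkE. Qed.

Lemma hom_funD M N (g h : homspace M N) x : hom_fun (g + h) x = hom_fun g x + hom_fun h x.
Proof. by have := hom_funP 1 g h x; rewrite scale1r /kscale !scale1r. Qed.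

Lemma hom_fun0 M N x : hom_fun (0 : homspace M N) x = 0.
Proof.
by rewrite -[LHS]/((0 : 'Hom(kspace M, kspace N)) x) zero_lfunE.
Qed.

Lemma hom_funZ M N (c : k) (h : homspace M N) x : hom_fun (c *: h) x = kscale c (hom_fun h x).
Proof. by have := hom_funP c h 0 x; rewrite hom_fun0 !addr0. Qed.

End Hom.

Section HomFunctor.
Variables (k : closedFieldType) (A B : falgType k) (S : rmod B).
Implicit Types X Y Z : rmod B.

(** The body of endomorphism_algebra, with the representation phi exposed
    because the functor Hom(S, -) depends on it. *)
Definition is_endomorphism_algebra (phi : A -> {linear S -> S}) : Prop :=
  [/\ forall s, phi 1 s = s,
      forall a b s, phi (a * b) s = phi a (phi b s),
      forall c a b s, phi (c *: a + b) s = kscale c (phi a s) + phi b s,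
      forall a b, phi a =1 phi b -> a = b
    & forall f : {linear S -> S}, exists a, phi a =1 f].

Variables (phi : A -> {linear S -> S}).
Hypothesis phiP : is_endomorphism_algebra phi.

Section Obj.
Variable X : rmod B.

Definition hom_act (u : homspace S X) (a : A) : homspace S X :=
  hom_mk (hom_fun u \o phi a : {linear S -> X}).

Lemma hom_actE u a s : hom_fun (hom_act u a) s = hom_fun u (phi a s).
Proof. exact: hom_mkE. Qed.

Fact hom_act_linearl a : linear (hom_act^~ a).
Proof. by move=> c u v; apply: hom_eq => s; rewrite hom_funP !hom_actE hom_funP. Qed.
Fact hom_act_linearr u : linear (hom_act u).
Proof.
case: phiP => _ _ phiD _ _ c a b; apply: hom_eq => s.
by rewrite hom_funP !hom_actE phiD linearD linear_kscale.
Qed.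
Fact hom_act1 u : hom_act u 1 = u.
Proof. by case: phiP => phi1 *; apply: hom_eq => s; rewrite hom_actE phi1. Qed.
Fact hom_actM u a b : hom_act u (a * b) = hom_act (hom_act u a) b.
Proof. by case: phiP => _ phiM *; apply: hom_eq => s; rewrite !hom_actE phiM. Qed.

Definition hom_right_action :=
  RightAction hom_act_linearl hom_act_linearr hom_act1 hom_actM.
(** Hom_B(S, X) as a right A-module: a acts by precomposition with phi a. *)
Definition hom_module : rmod A := action_module hom_right_action.

Definition hom_eval (u : hom_module) : {linear S -> X} := hom_fun (u : homspace S X).
Definition hom_of (f : {linear S -> X}) : hom_module := hom_mk f.

Lemma hom_ofE f s : hom_eval (hom_of f) s = f s. Proof. exact: hom_mkE. Qed.
Lemma hom_eval_eq u v : (forall s, hom_eval u s = hom_eval v s) -> u = v.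
Proof. exact: hom_eq. Qed.
Lemma hom_evalK u : hom_of (hom_eval u) = u. Proof. exact: hom_funK. Qed.
Lemma hom_eval_act (a : A) u s : hom_eval ((a : A^c) *: u) s = hom_eval u (phi a s).
Proof. exact: hom_actE. Qed.
Lemma hom_eval0 s : hom_eval 0 s = 0. Proof. exact: hom_fun0. Qed.
Lemma hom_evalD u v s : hom_eval (u + v) s = hom_eval u s + hom_eval v s. Proof. exact: hom_funD. Qed.
Lemma hom_eval_sum I (r : seq I) P (F : I -> hom_module) s :
  hom_eval (\sum_(i <- r | P i) F i) s = \sum_(i <- r | P i) hom_eval (F i) s.
Proof. elim/big_rec2: _ => [|i u v _ <-]; [exact: hom_eval0 | exact: hom_evalD]. Qed.
Lemma hom_eval_kscale (c : k) u s : hom_eval (kscale c u) s = kscale c (hom_eval u s).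
Proof. by rewrite /hom_eval action_module_kscale; apply: hom_funZ. Qed.

End Obj.

Fact hom_map_linear X Y (f : {linear X -> Y}) :
  linear (fun u : hom_module X => hom_of (f \o hom_eval u : {linear S -> Y})).
Proof.
by move=> a u v; apply: hom_eval_eq => s; rewrite hom_evalD hom_eval_act !hom_ofE /= hom_evalD hom_eval_act linearD.
Qed.

Definition hom_map X Y (f : {linear X -> Y}) : {linear hom_module X -> hom_module Y} :=
  linear_of (hom_map_linear f).

Lemma hom_mapE X Y (f : {linear X -> Y}) u s : hom_eval (hom_map f u) s = f (hom_eval u s).
Proof. exact: hom_ofE. Qed.

Lemma hom_map_id X (f : {linear X -> X}) : f =1 id -> hom_map f =1 id.
Proof. by move=> f1 u; apply: hom_eval_eq => s; rewrite hom_mapE f1. Qed.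

Lemma hom_map_comp X Y Z (f : {linear X -> Y}) (g : {linear Y -> Z})
  (h : {linear X -> Z}) : h =1 g \o f -> hom_map h =1 hom_map g \o hom_map f.
Proof. by move=> hE u; apply: hom_eval_eq => s; rewrite /= !hom_mapE hE. Qed.

Lemma hom_map_klinear X Y (c : k) (f g h : {linear X -> Y}) :
  (forall x, h x = kscale c (f x) + g x) ->
  forall y, hom_map h y = kscale c (hom_map f y) + hom_map g y.
Proof. by move=> hE u; apply: hom_eval_eq => s; rewrite hom_evalD hom_eval_kscale !hom_mapE hE. Qed.

Definition hom_functor : klinear_functor B A :=
  KLinearFunctor hom_map_id hom_map_comp hom_map_klinear.

End HomFunctor.

(** * Free modules, summands of powers, and injective modules *)

Section Regular.
Variables (k : closedFieldType) (L : falgType k).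
Implicit Types M N P Q I U V W X Y Z : rmod L.

Fact reg_linearl (a : L) : linear (fun v : L => v * a).
Proof. by move=> c x y; rewrite mulrDl scalerAl. Qed.
Fact reg_linearr (v : L) : linear (fun a : L => v * a).
Proof. by move=> c x y; rewrite mulrDr scalerAr. Qed.

Definition reg : rmod L :=
  action_module (RightAction reg_linearl reg_linearr (@mulr1 L) (@mulrA L)).

Lemma regE (a v : L) : (a : L^c) *: (v : reg) = v * a.
Proof. exact: action_moduleE. Qed.

Fact orbit_linear M (x : M) : linear (fun a : reg => (a : L^c) *: x).
Proof.
move=> a b c; rewrite -[in LHS]/((b : L) * (a : L)) scalerDl; congr (_ + _).
by rewrite scalerA.
Qed.

(** The isomorphism of M with Hom_L(L, M). *)
Definition orbit_map M (x : M) : {linear reg -> M} := linear_of (orbit_linear x).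

Lemma orbit_mapE M (x : M) (a : L) : orbit_map x a = (a : L^c) *: x.
Proof. by []. Qed.

Lemma orbit_map1 M (x : M) : orbit_map x (1 : L) = x.
Proof. by rewrite orbit_mapE scale1r. Qed.

Lemma reg_mapE M (f : {linear reg -> M}) (a : L) :
  f a = (a : L^c) *: f (1 : L).
Proof. by rewrite -linearZ regE mul1r. Qed.

Lemma orbit_comp M N (f : {linear M -> N}) x (a : L) :
  f (orbit_map x a) = orbit_map (f x) a.
Proof. by rewrite !orbit_mapE linearZ. Qed.

Lemma reg_projective : projective reg.
Proof.
move=> X Y g f g_surj; have [x gx] := g_surj (f (1 : L)).
by exists (orbit_map x) => a; rewrite orbit_comp gx orbit_mapE -reg_mapE.
Qed.

End Regular.

Section Powers.
Variables (k : closedFieldType) (L : falgType k).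
Implicit Types M N P Q I U V W X Y Z : rmod L.

Lemma power_fg n M : finitely_generated ({ffun 'I_n -> M} : lmodType L^c).
Proof.
have [m [g gP]] := fgmodP M.
apply: (@fg_finType L^c ('I_n * 'I_m)%type {ffun 'I_n -> M} (fun p =>
  [ffun i => if i == p.1 then g p.2 else 0])) => x.
have [c cE] := choice (fun i => gP (x i)); exists (fun p => c p.1 p.2).
apply/ffunP => i; rewrite sum_ffunE.
rewrite -(pair_bigA _ (fun i1 j =>
  (c i1 j *: ([ffun i0 => if i0 == i1 then g j else 0] : {ffun 'I_n -> M})) i)) /=.
rewrite (bigD1 i) //= [X in _ + X]big1 ?addr0 => [|j /negPf ji].
  by rewrite cE; apply: eq_bigr => j _; rewrite !ffunE eqxx.
by apply: big1 => l _; rewrite !ffunE eq_sym ji scaler0.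
Qed.

Definition power n M : rmod L := FGMod (power_fg n M).

Fact power_proj_linear n M i : linear (fun x : power n M => x i : M).
Proof. by move=> a x y; rewrite !ffunE. Qed.
Definition power_proj n M i : {linear power n M -> M} := linear_of (power_proj_linear (M := M) (i : 'I_n)).
Lemma power_projE n M i (x : power n M) : power_proj M i x = x i. Proof. by []. Qed.

Fact power_inj_linear n M (i : 'I_n) :
  linear (fun x : M => [ffun j => if j == i then x else 0] : power n M).
Proof.
by move=> a x y; apply/ffunP => j; rewrite !ffunE; case: eqP => // _; rewrite scaler0 addr0.
Qed.
Definition power_inj n M i : {linear M -> power n M} := linear_of (power_inj_linear (M := M) (i : 'I_n)).
Fact power_tuple_linear n X M (f : 'I_n -> {linear X -> M}) :
  linear (fun x => [ffun i => f i x] : power n M).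
Proof. by move=> a x y; apply/ffunP => j; rewrite !ffunE linearP. Qed.
Definition power_tuple n X M (f : 'I_n -> {linear X -> M}) : {linear X -> power n M} :=
  linear_of (power_tuple_linear f).
Lemma power_tupleE n X M (f : 'I_n -> {linear X -> M}) x i : power_tuple f x i = f i x.
Proof. by rewrite /= ffunE. Qed.

Fact lin_sum_linear (I : finType) X Y (f : I -> {linear X -> Y}) :
  linear (fun x => \sum_i f i x).
Proof.
move=> a x y; rewrite scaler_sumr -big_split.
by apply: eq_bigr => i _; rewrite linearP.
Qed.
Definition lin_sum (I : finType) X Y (f : I -> {linear X -> Y}) : {linear X -> Y} :=
  linear_of (lin_sum_linear f).
Lemma lin_sumE (I : finType) X Y (f : I -> {linear X -> Y}) x :
  lin_sum f x = \sum_i f i x.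
Proof. by []. Qed.

Definition power_cotuple n M X (f : 'I_n -> {linear M -> X}) : {linear power n M -> X} :=
  lin_sum (fun i => f i \o power_proj M i).
Lemma power_cotupleE n M X (f : 'I_n -> {linear M -> X}) (x : power n M) :
  power_cotuple f x = \sum_i f i (x i).
Proof. by []. Qed.

Lemma power_sum n M (x : power n M) : x = \sum_i power_inj M i (power_proj M i x).
Proof.
apply/ffunP => j; rewrite sum_ffunE (bigD1 j) //= ffunE eqxx big1 ?addr0 // => i ij.
by rewrite ffunE eq_sym (negPf ij).
Qed.

(** The closure add U.  The factorization of the identity through copies of U,
    rather than a summand of a power, makes it evident that additive functors
    preserve the relation. *)
Definition in_add U X : Prop := exists r (j : 'I_r -> {linear X -> U})
  (p : 'I_r -> {linear U -> X}), forall x, x = \sum_i p i (j i x).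

Lemma in_add_finType (I : finType) U X (j : I -> {linear X -> U})
  (p : I -> {linear U -> X}) : (forall x, x = \sum_i p i (j i x)) -> in_add U X.
Proof.
move=> pj; exists #|I|, (fun i => j (enum_val i)), (fun i => p (enum_val i)) => x.
by rewrite {1}(pj x) (big_enum_val (fun i => p i (j i x))).
Qed.

Definition retract X Y : Prop := exists (j : {linear X -> Y}) (p : {linear Y -> X}),
  forall x, p (j x) = x.

Lemma retract_in_add U X : retract X U -> in_add U X.
Proof.
case=> j [p pj]; exists 1%N, (fun=> j), (fun=> p) => x.
by rewrite big_ord1 pj.
Qed.

Lemma retract_refl X : retract X X.
Proof. by exists (idfun : {linear X -> X}), (idfun : {linear X -> X}). Qed.

Lemma iso_retract X Y : isomorphic X Y -> retract X Y.
Proof. by case=> f /inv_linear[g [fK _]]; exists f, g. Qed.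

Lemma in_add_refl X : in_add X X.
Proof. exact/retract_in_add/retract_refl. Qed.

Lemma in_add_trans U V X : in_add U X -> in_add V U -> in_add V X.
Proof.
case=> r [j [p pj]] [s [l [q ql]]].
apply: (@in_add_finType ('I_r * 'I_s)%type V X (fun c => l c.2 \o j c.1)
  (fun c => p c.1 \o q c.2)) => x.
rewrite {1}(pj x) -(pair_bigA _ (fun a b => p a (q b (l b (j a x))))) /=.
by apply: eq_bigr => i _; rewrite -linear_sum -ql.
Qed.

Lemma power_in_add n M : in_add M (power n M).
Proof. exists n, (fun i => power_proj M i), (fun i => power_inj M i); exact: power_sum. Qed.

Lemma in_add_projective U X : projective U -> in_add U X -> projective X.
Proof.
move=> Up [r [j [p pj]]] Y Z g f g_surj.
have [h hE] := choice (fun i => Up Y Z g (f \o p i : {linear U -> Z}) g_surj).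
exists (lin_sum (fun i => h i \o j i)) => x.
rewrite {2}(pj x) lin_sumE !linear_sum; apply: eq_bigr => i _; exact: hE.
Qed.

Lemma in_add_injective U X : injective_mod U -> in_add U X -> injective_mod X.
Proof.
move=> Ui [r [j [p pj]]] Y Z g f g_inj.
have [h hE] := choice (fun i => Ui Y Z g (j i \o f : {linear Y -> U}) g_inj).
exists (lin_sum (fun i => p i \o h i)) => x.
rewrite [RHS](pj (f x)) lin_sumE; apply: eq_bigr => i _; rewrite /= hE; reflexivity.
Qed.

Lemma reg_cover M : exists n (p : {linear power n (reg L) -> M}), surj p.
Proof.
have [n [g gP]] := fgmodP M; exists n, (power_cotuple (fun i => orbit_map (g i))) => x.
have [c ->] := gP x; exists [ffun i => c i : L].
by rewrite power_cotupleE; apply: eq_bigr => i _; rewrite ffunE.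
Qed.

Lemma surj_projective M P (p : {linear M -> P}) :
  projective P -> surj p -> retract P M.
Proof.
move=> Pp p_surj; have [s sE] := Pp _ _ p (idfun : {linear P -> P}) p_surj.
by exists s, p.
Qed.

Lemma inj_injective M I (i : {linear I -> M}) :
  injective_mod I -> injective i -> retract I M.
Proof.
move=> Ii i_inj; have [s sE] := Ii _ _ i (idfun : {linear I -> I}) i_inj.
by exists i, s.
Qed.

Lemma projectiveP P : projective P <-> in_add (reg L) P.
Proof.
split=> [Pp|]; last exact/in_add_projective/reg_projective.
have [n [p p_surj]] := reg_cover P.
exact: in_add_trans (retract_in_add (surj_projective Pp p_surj)) (power_in_add _ _).
Qed.

(** Injectivity with respect to an arbitrary map g: a map that vanishes on the
    kernel of g factors through the image of g, which is a submodule of Y. *)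
Lemma injective_factor I X Y (g : {linear X -> Y}) (f : {linear X -> I}) :
  injective_mod I -> (forall x, g x = 0 -> f x = 0) ->
  exists h : {linear Y -> I}, forall x, h (g x) = f x.
Proof.
move=> Ii gf0.
have [W [i [i_inj iP]]] := submodP (image_submodule g).
have [|g' g'E] := @factor_inj _ _ _ _ i g i_inj; first by move=> x; apply/iP; exists x.
have g'_surj : surj g'.
  by move=> w; have /iP[x gx] : exists y, i y = i w by [exists w]; exists x; apply: i_inj; rewrite g'E.
have [|f' f'E] := @factor_surj _ _ _ _ g' f g'_surj.
  by move=> x g'x; apply: gf0; rewrite -g'E g'x linear0.
have [h hE] := Ii _ _ i f' i_inj.
by exists h => x; rewrite -g'E hE f'E.
Qed.

End Powers.

Section Dual.
Variables (k : closedFieldType) (C : falgType k) (V : vectType k).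
Variable l : C -> V -> V.
Hypotheses (l_linearl : forall v, linear (l^~ v)) (l_linearr : forall a, linear (l a))
  (l1 : forall v, l 1 v = v) (lM : forall a b v, l (a * b) v = l a (l b v)).

Definition dual_act (xi : 'Hom(V, k^o)) (a : C) : 'Hom(V, k^o) :=
  linfun (xi \o linear_of (l_linearr a)).

Lemma dual_actE xi a v : dual_act xi a v = xi (l a v).
Proof. by rewrite lfunE. Qed.

Fact dual_act_linearl a : linear (dual_act^~ a).
Proof.
by move=> c x y; apply/lfunP => v; rewrite !(add_lfunE, scale_lfunE, dual_actE).
Qed.
Fact dual_act_linearr xi : linear (dual_act xi).
Proof.
move=> c a b; apply/lfunP => v; rewrite !(add_lfunE, scale_lfunE, dual_actE).
by rewrite (l_linearl v) linearP.
Qed.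
Fact dual_act1 xi : dual_act xi 1 = xi.
Proof. by apply/lfunP => v; rewrite dual_actE l1. Qed.
Fact dual_actM xi a b : dual_act xi (a * b) = dual_act (dual_act xi a) b.
Proof. by apply/lfunP => v; rewrite !dual_actE lM. Qed.

(** The dual D V of a left C-module V, with the right action
    (xi c)(v) = xi (c v). *)
Definition dual_mod : rmod C :=
  action_module (RightAction dual_act_linearl dual_act_linearr dual_act1 dual_actM).

End Dual.

Section Functionals.
Variables (k : fieldType) (V : vectType k).

Definition coordf (i : 'I_(\dim {:V})) : 'Hom(V, k^o) :=
  linfun (coord (vbasis {:V}) i : V -> k^o).

Lemma coordf_sum v : v = \sum_i coordf i v *: (vbasis {:V})`_i.
Proof.
rewrite {1}(coord_vbasis (memvf v)); apply: eq_bigr => i _.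
by rewrite lfunE.
Qed.

Lemma functional_sep v : (forall xi : 'Hom(V, k^o), xi v = 0) -> v = 0.
Proof.
by move=> v0; rewrite (coordf_sum v) big1 // => i _; rewrite v0 scale0r.
Qed.

End Functionals.

Section Injectives.
Variables (k : closedFieldType) (L : falgType k).
Implicit Types M N P Q I U V W X Y Z : rmod L.

(** The injective cogenerator D L. *)
Definition coreg : rmod L :=
  @dual_mod k L L *%R (@reg_linearl k L) (@reg_linearr k L) (@mul1r L)
    (fun a b c => esym (mulrA a b c)).

Fact cofree_linear M (xi : 'Hom(kspace M, k^o)) :
  linear (fun x : M => linfun (xi \o linear_of (act_linearr x)) : coreg).
Proof.
move=> a x y; apply/lfunP => b; rewrite add_lfunE [in RHS]dual_actE !lfunE /=.
by rewrite scalerDr linearD scalerA.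
Qed.

(** The isomorphism of D M with Hom_L(M, D L), inverted by coreg_map. *)
Definition cofree M (xi : 'Hom(kspace M, k^o)) : {linear M -> coreg} :=
  linear_of (cofree_linear xi).

Lemma cofreeE M (xi : 'Hom(kspace M, k^o)) (x : M) (a : L) :
  (cofree xi x : 'Hom(L, k^o)) a = xi ((a : L^c) *: x).
Proof. by rewrite lfunE. Qed.

Lemma coreg_map M (f : {linear M -> coreg}) : exists xi, forall x, f x = cofree xi x.
Proof.
have lin_xi : linear (fun x : kspace M => (f x : 'Hom(L, k^o)) 1 : k^o).
  move=> c x y; rewrite linearD add_lfunE; congr (_ + _).
  rewrite kspaceZ linear_kscale action_module_kscale; exact: scale_lfunE.
exists (linfun (linear_of lin_xi)) => x; apply/lfunP => a.
by rewrite cofreeE lfunE /= linearZ dual_actE mulr1.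
Qed.

(** Maps into D L are functionals, and functionals extend along injections of
    vector spaces. *)
Lemma coreg_injective : injective_mod coreg.
Proof.
move=> X Y g f g_inj; have [xi fE] := coreg_map f.
exists (cofree (xi \o (klinear g)^-1)%VF) => x; rewrite fE; apply/lfunP => a.
rewrite !cofreeE comp_lfunE -linearZ -klinearE lker0_lfunK //.
by apply/lker0P => u v; rewrite !klinearE; apply: g_inj.
Qed.

Lemma coreg_sep M (x : M) : (forall u : {linear M -> coreg}, u x = 0) -> x = 0.
Proof.
move=> x0; apply: (@functional_sep k (kspace M)) => xi.
have := congr1 (fun h : 'Hom(L, k^o) => h 1) (x0 (cofree xi)).
by rewrite cofreeE scale1r zero_lfunE.
Qed.

(** The coordinate functionals of M embed it into a power of D L. *)
Lemma enough_injectives M :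
  exists (I : rmod L) (i : {linear M -> I}), injective_mod I /\ injective i.
Proof.
exists (power (\dim {:kspace M}) coreg), (power_tuple (fun i => cofree (coordf i))); split.
  exact: in_add_injective coreg_injective (power_in_add _ _).
apply/inj0P => x x0; rewrite (@coordf_sum k (kspace M) x) big1 // => i _.
have := congr1 (fun h : power _ coreg => (h i : 'Hom(L, k^o)) 1) x0.
by rewrite power_tupleE cofreeE scale1r ffunE zero_lfunE => ->; rewrite scale0r.
Qed.

End Injectives.

(** * Projective dimension at most one *)

Section ProjectiveDimension.
Variables (k : closedFieldType) (L : falgType k).
Implicit Types M N P Q I U V W X Y Z K : rmod L.

Definition zero_module : rmod L := power 0 (reg L).
Lemma zero_moduleP : zero_mod zero_module.
Proof. by move=> x; apply/ffunP => -[]. Qed.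

Lemma zero_projective X : zero_mod X -> projective X.
Proof.
move=> X0 Y Z g f _; exists (\0 : {linear X -> Y}) => x.
by rewrite (X0 x) !linear0.
Qed.

Lemma iso_projective X Y : isomorphic X Y -> projective Y -> projective X.
Proof. by move=> /iso_retract/retract_in_add XY /in_add_projective; apply. Qed.

Lemma pd_le0P M : pd_le M 0 <-> projective M.
Proof.
split=> [[P [d [e [[Pp e_surj ex _] P0]]]]|Mp].
  apply: iso_projective (Pp 0%N); apply: isomorphic_sym; exists e; apply: bijectiveP => //.
  by apply/inj0P => x /ex[y <-]; rewrite (P0 1%N isT y) linear0.
exists (fun i => if i is 0%N then M else zero_module), (fun i => \0), (idfun : {linear M -> M}).
split; last by case=> // i _; apply: zero_moduleP.
split=> [[|i]||y|i y] //=; first exact/zero_projective/zero_moduleP.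
- by move=> y; exists y.
- by split=> [->|[x <-]] //; exists 0.
- by split=> // _; exists 0; rewrite (zero_moduleP y).
Qed.

Definition short_projective M :=
  exists P1 P0 (d : {linear P1 -> P0}) (e : {linear P0 -> M}),
  [/\ projective P1, projective P0, injective d, surj e & exact_at d e].

(** In a resolution with P_2 = 0 the map P_1 -> P_0 is injective. *)
Lemma pd_le1P M : pd_le M 1 <-> short_projective M.
Proof.
split=> [[P [d [e [[Pp e_surj ex exd] P0]]]]|[P1 [P0 [d [e [P1p P0p d_inj e_surj ex]]]]]].
  exists (P 1%N), (P 0%N), (d 0%N), e; split=> //.
  by apply/inj0P => x /exd[y <-]; rewrite (P0 2%N isT y) linear0.
pose P i : rmod L := match i with 0%N => P0 | 1%N => P1 | _ => zero_module end.
pose d' i : {linear P i.+1 -> P i} := if i is 0%N then d else \0.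
exists P, d', e.
split; last by case=> [|[|i]] // _; apply: zero_moduleP.
split=> [[|[|i]]|||[|i] y] //=.
- exact/zero_projective/zero_moduleP.
- split=> [|[_ <-]]; last by rewrite linear0.
  by have /inj0P d0 := d_inj; move=> /d0 ->; exists 0.
- by split=> [_|//]; exists 0; case: i y => [|i] y; rewrite (zero_moduleP y).
Qed.

Lemma pd_le_projective M : projective M -> pd_le M 1.
Proof.
move=> Mp; apply/pd_le1P; exists zero_module, M, \0, (idfun : {linear M -> M}); split=> //.
- exact/zero_projective/zero_moduleP.
- by move=> x y _; rewrite (zero_moduleP x) (zero_moduleP y).
- by move=> y; exists y.
- by move=> y; split=> /= [->|[x <-]] //; exists 0.
Qed.

(** Schanuel's lemma, in the form that is needed: lifting p and e against each
    other exhibits the kernel K of p as a retract of P1 + P. *)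
Lemma kernel_projective M P K (p : {linear P -> M}) (i : {linear K -> P}) :
  pd_le M 1 -> projective P -> surj p -> injective i -> exact_at i p -> projective K.
Proof.
move=> /pd_le1P[P1 [P0 [d [e [P1p P0p d_inj e_surj ex]]]]] Pp p_surj i_inj ex'.
have [a aE] := Pp _ _ e p e_surj; have [b bE] := P0p _ _ p e p_surj.
have [|a' a'E] := @factor_inj _ _ _ _ d (a \o i : {linear K -> P0}) d_inj.
  by move=> x; apply/ex; rewrite /= aE; apply/ex'; exists x.
have [|b' b'E] := @factor_inj _ _ _ _ i (b \o d : {linear P1 -> P}) i_inj.
  by move=> x; apply/ex'; rewrite /= bE; apply/ex; exists x.
have [|c cE] := @factor_inj _ _ _ _ i (idfun \- (b \o a) : {linear P -> P}) i_inj.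
  by move=> x; apply/ex'; rewrite /= linearB bE aE subrr.
(* K -> P1 + P -> K is x |-> (a' x, i x) followed by (y, z) |-> b' y + c z,
   where c is the restriction of 1 - b a. *)
have retr x : b' (a' x) + c (i x) = x.
  by apply: i_inj; rewrite linearD b'E cE /= a'E /= addrC subrK.
move=> X Y g f g_surj.
have [h1 h1E] := P1p _ _ g (f \o b' : {linear P1 -> Y}) g_surj.
have [h2 h2E] := Pp _ _ g (f \o c : {linear P -> Y}) g_surj.
exists ((h1 \o a') \+ (h2 \o i) : {linear K -> X}) => x.
by rewrite /= linearD h1E h2E /= -linearD retr.
Qed.

End ProjectiveDimension.

(** * Fitting's lemma, indecomposable summands and injective envelopes *)

Section Fitting.
Variables (k : closedFieldType) (L : falgType k).
Implicit Types M N P Q I U V W X Y Z K : rmod L.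

Fact iter_linear M (f : {linear M -> M}) n : linear (iter n f).
Proof. by elim: n => [|n IHn] a x y //=; rewrite IHn linearP. Qed.

Definition iterl M (f : {linear M -> M}) n : {linear M -> M} :=
  linear_of (iter_linear f n).

(** Choose a positive power of f of least rank: squaring it does not lower the rank, so
    its kernel meets its image trivially. *)
Lemma rank_stable M (f : {linear M -> M}) :
  exists n, forall x, iter n.+1 f (iter n.+1 f x) = 0 -> iter n.+1 f x = 0.
Proof.
pose rk n : nat := \dim (limg (klinear (iterl f n.+1))).
pose P (d : nat) := `[< exists n, rk n = d >].
have exP : exists d, P d by exists (rk 0%N); apply/asboolP; exists 0%N.
case: (ex_minnP exP) => d /asboolP[n rkn] d_min; exists n => x ggx.
pose g := klinear (iterl f n.+1).
have gE z : g z = iter n.+1 f z by rewrite klinearE.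
have le_rk : (\dim (limg g) <= \dim (g @: limg g))%N.
  rewrite -limg_comp [X in (X <= _)%N]rkn.
  apply: d_min; apply/asboolP; exists (n.+1 + n)%N; rewrite /rk; congr (\dim (limg _)).
  by apply/lfunP => z; rewrite comp_lfunE !klinearE !linear_ofE -addnS iterD.
have := limg_ker_dim g (limg g) => /eqP.
have /eqP/eqP -> : \dim (g @: limg g) = \dim (limg g).
  apply/eqP; rewrite eqn_leq le_rk andbT; apply: dimvS.
  exact: limgS (subvf _).
rewrite -{2}[\dim (limg g)]add0n eqn_add2r dimv_eq0 => /eqP ker0.
have : (iter n.+1 f x : kspace M) \in 0%VS; last by rewrite memv0 => /eqP.
by rewrite -ker0 memv_cap memv_ker gE ggx eqxx -gE memv_img ?memvf.
Qed.

(** Fitting's decomposition M = Ker g + Im g for a power g of f, given by the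
    projection e onto Im g along Ker g. *)
Lemma fitting M (f : {linear M -> M}) : exists n (e : {linear M -> M}),
  [/\ forall x, e (e x) = e x,
      forall x, e x = 0 <-> iter n.+1 f x = 0
    & forall x, e (iter n.+1 f x) = iter n.+1 f x].
Proof.
have [n ker_stable] := rank_stable f; exists n.
set g := iterl f n.+1.
have [N [i [i_inj iP]]] := submodP (image_submodule g).
have [|g' g'E] := @factor_inj _ _ _ _ i g i_inj; first by move=> x; apply/iP; exists x.
(* g' is g with codomain restricted to its image N, so g' i is the restriction
   of g to N, which is bijective. *)
have g'i_inj : injective (g' \o i).
  apply/inj0P => y /= /(congr1 i); rewrite g'E linear0.
  have /iP[x gx] : exists z, i z = i y by exists y.
  rewrite -gx => /ker_stable gx0; have /inj0P := i_inj; apply.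
  by rewrite -gx; exact: gx0.
have [h [hK Kh]] : exists h : {linear N -> N}, cancel (g' \o i) h /\ cancel h (g' \o i).
  by apply: inv_linear; apply: bijectiveP => //; apply: mdim_inj_surj.
exists (i \o h \o g' : {linear M -> M}).
have e_im x : i (h (g' (g x))) = g x by rewrite -[in LHS]g'E (hK (g' x)) g'E.
split=> [x|x|x]; last exact: e_im.
  by rewrite /=; congr (i (h _)); exact: (Kh (g' x)).
have -> : iter n.+1 f x = i (g' x) by rewrite g'E.
rewrite /=.
split=> [ih0|/(congr1 (fun y => g' y))].
  have /inj0P i0 := i_inj; have := congr1 (g' \o i) (i0 _ ih0).
  by rewrite Kh linear0 => ->; rewrite linear0.
have /inj0P i0 := i_inj; have /inj0P gi0 := g'i_inj.
by rewrite linear0 => /gi0 ->; rewrite !linear0.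
Qed.

Lemma split_idempotent M (e : {linear M -> M}) : (forall x, e (e x) = e x) ->
  exists X (j : {linear X -> M}) (p : {linear M -> X}),
    (forall x, p (j x) = x) /\ forall x, j (p x) = e x.
Proof.
move=> ee; have [X [j [j_inj jP]]] := submodP (image_submodule e).
have [|p pE] := @factor_inj _ _ _ _ j e j_inj; first by move=> x; apply/jP; exists x.
exists X, j, p; split=> // x; apply: j_inj; rewrite pE.
by have /jP[y <-] : exists z, j z = j x by exists x.
Qed.

Lemma indec_idempotent M (e : {linear M -> M}) : indecomposable M ->
  (forall x, e (e x) = e x) -> (forall x, e x = 0) \/ (forall x, e x = x).
Proof.
move=> [_ M_indec] ee.
have [X [j [p [pj jp]]]] := split_idempotent ee.
have [|Y [l [q [ql lq]]]] := @split_idempotent M (idfun \- e).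
  by move=> x; rewrite /= linearB ee subrr subr0.
have pl y : p (l y) = 0.
  rewrite -[y]ql lq /= linearB -[p (e _)]pj jp ee -jp pj subrr; reflexivity.
have qj y : q (j y) = 0.
  rewrite -[y]pj jp -[q _]ql lq /= ee subrr linear0; reflexivity.
have lin : linear (fun x => (p x, q x) : X * Y).
  by move=> a x y; rewrite !linearP.
have iso : isomorphic M (X * Y)%type.
  exists (linear_of lin); exists (fun z => j z.1 + l z.2) => [x|[x y]] /=.
    by rewrite jp lq /= addrC subrK.
  by rewrite !linearD pj ql pl qj addr0 add0r.
case: (M_indec _ _ iso) => [X0|Y0]; [left|right] => x.
  by rewrite -jp (X0 (p x)) linear0.
by apply/esym/eqP; rewrite -subr_eq0 -[_ - _]/((idfun \- e) x) -lq (Y0 (q x)) linear0.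
Qed.

Lemma indec_bij_nil M (f : {linear M -> M}) : indecomposable M ->
  bijective f \/ exists n, forall x, iter n f x = 0.
Proof.
move=> M_indec; have [n [e [ee e0 eg]]] := fitting f.
case: (indec_idempotent M_indec ee) => [e_0|e_1]; [right|left].
  by exists n.+1 => x; apply/e0.
have f_inj : injective f.
  apply/inj0P => x fx0; rewrite -(e_1 x); apply/e0; rewrite iterSr fx0.
  by rewrite -[iter n f 0]/(iterl f n 0) linear0.
by apply: bijectiveP => //; apply: mdim_inj_surj.
Qed.

(** The ring of endomorphisms of an indecomposable module is local: after
    composing with the inverse of s, one of the two terms is nilpotent or
    bijective, and 1 - f is injective when f is nilpotent. *)
Lemma indec_bij_add M (f g s : {linear M -> M}) : indecomposable M ->
  (forall x, s x = f x + g x) -> bijective s -> bijective f \/ bijective g.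
Proof.
move=> M_indec sE s_bij; have [t [sK tK]] := inv_linear s_bij.
case: (indec_bij_nil (t \o f : {linear M -> M}) M_indec) => [tf_bij|[n tf_nil]]; [left|right].
  apply: (eq_bij (bij_comp s_bij tf_bij)) => x; exact: tK.
have tg_inj : injective (t \o g).
  apply/inj0P => x /= tgx0.
  have xE : x = t (f x) by rewrite -[LHS]sK sE linearD tgx0 addr0.
  rewrite -(tf_nil x); elim: n {tf_nil} => //= m IHm.
  by rewrite -IHm.
apply: (eq_bij (bij_comp s_bij _)) (_ : _ =1 g); last by move=> x; apply: tK.
by apply: (@bijectiveP _ _ _ (t \o g : {linear M -> M})) => //; apply: mdim_inj_surj.
Qed.

Lemma indec_bij_sum M (I : eqType) (r : seq I) (f : I -> {linear M -> M})
    (s : {linear M -> M}) : indecomposable M ->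
  (forall x, s x = \sum_(i <- r) f i x) -> bijective s -> exists i, bijective (f i).
Proof.
move=> M_indec; elim: r s => [|i r IHr] s sE s_bij.
  case: (M_indec) => M0 _; case: M0 => x.
  by have [t [sK _]] := inv_linear s_bij; rewrite -[x]sK sE big_nil linear0.
have lin : linear (fun x => \sum_(j <- r) f j x).
  move=> a x y; rewrite scaler_sumr -big_split.
  by apply: eq_bigr => j _; rewrite linearP.
have [] := @indec_bij_add M (f i) (linear_of lin) s M_indec _ s_bij.
- by move=> x; rewrite sE big_cons.
- by exists i.
- exact: IHr.
Qed.

(** The Krull-Schmidt argument: one of the endomorphisms p_i j_i of X is
    bijective by locality, so X is a nonzero summand of the indecomposable N i. *)
Lemma indec_summand X (I : finType) (N : I -> rmod L)
    (j : forall i, {linear X -> N i}) (p : forall i, {linear N i -> X}) :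
  indecomposable X -> (forall i, indecomposable (N i)) ->
  (forall x, x = \sum_i p i (j i x)) -> exists i, isomorphic X (N i).
Proof.
move=> X_indec N_indec pj.
have [||i u_bij] := @indec_bij_sum X I (index_enum I) (fun i => p i \o j i) idfun X_indec.
- exact: pj.
- by exists id.
have [v [vK Kv]] := inv_linear u_bij.
exists i, (j i).
have [|e0|e1] := @indec_idempotent (N i) (j i \o v \o p i) (N_indec i).
- by move=> x /=; congr (j i _); exact: (vK (v (p i x))).
- case: X_indec => X0 _; case: X0 => x.
  have := e0 (j i x); rewrite /= => /(congr1 (p i)); rewrite linear0.
  by rewrite [v _](vK x) => /(congr1 v); rewrite linear0 [v _](vK x).
exists (v \o p i) => x; [exact: (vK x) | exact: e1].
Qed.

(** Induction on the dimension.  The index type is an arbitrary finite type so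
    that the families of two summands can be put together on a sum type. *)
Lemma indec_decomposition M : exists (I : finType) (N : I -> rmod L)
    (j : forall i, {linear N i -> M}) (p : forall i, {linear M -> N i}),
  [/\ forall i, indecomposable (N i), forall i x, p i (j i x) = x
    & forall x, x = \sum_i j i (p i x)].
Proof.
elim: {M}_.+1 {-2}M (ltnSn (mdim M)) => // n IHn M; rewrite ltnS => le_Mn.
case: (EM (zero_mod M)) => [M0|M_n0].
  exists 'I_0, (fun=> M), (fun=> idfun), (fun=> idfun); split=> // [[]|x] //.
  by rewrite big_ord0.
case: (EM (indecomposable M)) => [M_indec|M_dec].
  exists unit, (fun=> M), (fun=> idfun), (fun=> idfun); split=> // x.
  by rewrite (big_pred1 tt) //; case.
have [X [Y [iso [X_n0 Y_n0]]]] : exists X Y : rmod L,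
    isomorphic M (X * Y)%type /\ ~ zero_mod X /\ ~ zero_mod Y.
  apply: contrapT => noXY; apply: M_dec; split=> // X Y iso.
  apply: contrapT => /not_orP[X_n0 Y_n0]; apply: noXY; exists X, Y; do !split=> //.
case: iso => f /inv_linear[g [fK gK]].
have lin1 : linear (fun x : X => g (x, 0)).
  by move=> a x y; rewrite -linearP; congr (g _); apply: injective_projections; rewrite /= ?scaler0 ?addr0.
have lin2 : linear (fun y : Y => g (0, y)).
  by move=> a x y; rewrite -linearP; congr (g _); apply: injective_projections; rewrite /= ?scaler0 ?addr0.
have lin3 : linear (fun x : M => (f x).1) by move=> a x y; rewrite linearP.
have lin4 : linear (fun x : M => (f x).2) by move=> a x y; rewrite linearP.
have sumE x : x = g ((f x).1, 0) + g (0, (f x).2).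
  rewrite -linearD -[LHS]fK; congr (g _).
  by apply: injective_projections; rewrite /= ?addr0 ?add0r.
have ltX : (mdim X < mdim M)%N.
  apply: (@mdim_lt _ _ _ _ (linear_of lin1)) => [|lin1_surj].
    by move=> x y /(can_inj gK)[].
  apply: Y_n0 => y; have [x] := lin1_surj (g (0, y)).
  by move=> /(can_inj gK)[_ <-].
have ltY : (mdim Y < mdim M)%N.
  apply: (@mdim_lt _ _ _ _ (linear_of lin2)) => [|lin2_surj].
    by move=> x y /(can_inj gK)[].
  apply: X_n0 => x; have [y] := lin2_surj (g (x, 0)).
  by move=> /(can_inj gK)[<- _].
have [I1 [N1 [j1 [p1 [N1_indec pj1 s1]]]]] := IHn X (leq_trans ltX le_Mn).
have [I2 [N2 [j2 [p2 [N2_indec pj2 s2]]]]] := IHn Y (leq_trans ltY le_Mn).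
pose N i : rmod L := match i with inl i => N1 i | inr i => N2 i end.
pose j i : {linear N i -> M} := match i return {linear N i -> M} with
  inl i => linear_of lin1 \o j1 i | inr i => linear_of lin2 \o j2 i end.
pose p i : {linear M -> N i} := match i return {linear M -> N i} with
  inl i => p1 i \o linear_of lin3 | inr i => p2 i \o linear_of lin4 end.
exists (I1 + I2)%type, N, j, p.
split=> [[i|i]|[i|i] x|x] //=; rewrite ?gK; [exact: pj1|exact: pj2|].
rewrite big_sumType /= {1}(sumE x); congr (_ + _).
  by rewrite {1}(s1 (f x).1) -[LHS]/(linear_of lin1 _) linear_sum.
by rewrite {1}(s2 (f x).2) -[LHS]/(linear_of lin2 _) linear_sum.
Qed.

(** Injective envelopes.  Take an injective module of least dimension among
    those that contain M.  If a submodule N meets M trivially, the map M + N -> M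
    extends to an endomorphism h of I that fixes M and kills N; the Fitting
    summand Im h^m still contains M, so by minimality it is I, and N = 0. *)
Lemma injective_hull M : exists I (i : {linear M -> I}),
  [/\ injective_mod I, injective i
    & forall N (n : {linear N -> I}), injective n ->
      (forall x y, i x = n y -> n y = 0) -> zero_mod N].
Proof.
pose P (d : nat) := `[< exists I (i : {linear M -> I}),
  [/\ injective_mod I, injective i & mdim I = d] >].
have exP : exists d, P d.
  have [I [i [Ii i_inj]]] := enough_injectives M.
  by exists (mdim I); apply/asboolP; exists I, i.
case: (ex_minnP exP) => d /asboolP[I [i [Ii i_inj dI]]] d_min.
exists I, i; split=> // N n n_inj ni y.
pose MN : rmod L := FGMod (fg_pair (fgmodP M) (fgmodP N)).
have lin1 : linear (fun z : MN => i z.1 + n z.2).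
  by move=> a u v; rewrite /= !linearP scalerDr addrACA.
have lin2 : linear (fun z : MN => i z.1).
  by move=> a u v; rewrite /= !linearP.
have [|h hE] := @injective_factor _ _ I MN I (linear_of lin1) (linear_of lin2) Ii.
  move=> [u v] /= /eqP; rewrite addr_eq0 -linearN => /eqP iu.
  by rewrite iu; apply: ni iu.
have hi x : h (i x) = i x by have := hE (x, 0); rewrite /= linear0 addr0.
have hn x : h (n x) = 0 by have := hE (0, x); rewrite /= !linear0 add0r.
have [m [e [ee e0 eg]]] := fitting h.
have ei x : e (i x) = i x.
  by have it : iter m.+1 h (i x) = i x; [elim: m.+1 => //= ? -> | rewrite -{1}it eg it].
have en x : e (n x) = 0.
  by apply/e0; rewrite iterSr hn -[iter m h 0]/(iterl h m 0) linear0.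
have [X [j [p [pj jp]]]] := split_idempotent ee.
have le_IX : (mdim I <= mdim X)%N.
  rewrite dI; apply: d_min; apply/asboolP; exists X, (p \o i); split=> //.
    by apply: in_add_injective Ii (retract_in_add _); exists j, p.
  by move=> u v /= /(congr1 j); rewrite !jp !ei => /i_inj.
have j_inj : injective j by apply: can_inj pj.
have [z jz] := mdim_inj_surj j_inj le_IX (n y).
apply: n_inj; rewrite linear0 -jz -[z]pj jp; rewrite jz.
exact: en.
Qed.

End Fitting.

(** * Endomorphism algebras and full faithfulness of Hom(S, -) *)

Section EndAlgebra.
Variables (k : closedFieldType) (L : falgType k) (M : rmod L).
Hypothesis M_nz : ~ zero_mod M.

(** The proof that M is nonzero is a parameter of the type because the algebra
    structure requires 1 and 0 to differ. *)
Definition endo_type (nz : ~ zero_mod M) : Type := homspace M M.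
Local Notation E := (endo_type M_nz).

HB.instance Definition _ := Vector.copy E (homspace M M).

Definition endo_mul (f g : E) : E := hom_mk (hom_fun f \o hom_fun g : {linear M -> M}).
Definition endo_one : E := hom_mk (idfun : {linear M -> M}).

Lemma endo_mulE f g x : hom_fun (endo_mul f g) x = hom_fun f (hom_fun g x).
Proof. exact: hom_mkE. Qed.
Lemma endo_oneE x : hom_fun endo_one x = x.
Proof. exact: hom_mkE. Qed.
Let addE (f g : E) x : hom_fun (f + g : E) x = hom_fun f x + hom_fun g x.
Proof. exact: hom_funD. Qed.
Let scaleE (c : k) (f : E) x : hom_fun (c *: f : E) x = kscale c (hom_fun f x).
Proof. exact: hom_funZ. Qed.

Fact endo_mulA : associative endo_mul.
Proof. by move=> f g h; apply: hom_eq => x; rewrite !endo_mulE. Qed.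
Fact endo_mul1l : left_id endo_one endo_mul.
Proof. by move=> f; apply: hom_eq => x; rewrite endo_mulE endo_oneE. Qed.
Fact endo_mul1 : right_id endo_one endo_mul.
Proof. by move=> f; apply: hom_eq => x; rewrite endo_mulE endo_oneE. Qed.
Fact endo_mulDl : left_distributive endo_mul +%R.
Proof. by move=> f g h; apply: hom_eq => x; rewrite endo_mulE !addE !endo_mulE. Qed.
Fact endo_mulDr : right_distributive endo_mul +%R.
Proof. by move=> f g h; apply: hom_eq => x; rewrite endo_mulE !addE !endo_mulE linearD. Qed.
Fact endo_one_neq0 : endo_one != 0.
Proof.
apply/eqP => e0; apply: M_nz => x.
by rewrite -(endo_oneE x) e0; apply: hom_fun0.
Qed.
HB.instance Definition _ := GRing.Zmodule_isNzRing.Build E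
  endo_mulA endo_mul1l endo_mul1 endo_mulDl endo_mulDr endo_one_neq0.

Fact endo_scaleAl (c : k) (f g : E) : c *: (f * g) = (c *: f) * g.
Proof. by apply: hom_eq => x; rewrite scaleE !endo_mulE scaleE. Qed.
HB.instance Definition _ := GRing.Lmodule_isLalgebra.Build k E endo_scaleAl.

Fact endo_scaleAr (c : k) (f g : E) : c *: (f * g) = f * (c *: g).
Proof.
by apply: hom_eq => x; rewrite scaleE !endo_mulE scaleE linear_kscale.
Qed.
HB.instance Definition _ := GRing.Lalgebra_isAlgebra.Build k E endo_scaleAr.
HB.instance Definition _ := Algebra_isFalgebra.Build k E.

Lemma endo_algebraP : @is_endomorphism_algebra k E L M (fun f : E => hom_fun f).
Proof.
split=> [|f g x|c f g x|f g fg|f].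
- exact: endo_oneE.
- exact: endo_mulE.
- exact: hom_funP.
- exact: hom_eq fg.
- exists (hom_mk f); exact: hom_mkE.
Qed.

End EndAlgebra.

Section FullyFaithful.
Variables (k : closedFieldType) (A B : falgType k) (S : rmod B).
Variables (phi : A -> {linear S -> S}).
Hypothesis phiP : is_endomorphism_algebra phi.
Implicit Types X Y Z N : rmod B.
Local Notation hom_module := (hom_module phiP).
Local Notation hom_map := (hom_map phiP).
Local Notation hom_of := (@hom_of _ _ _ _ _ phiP _).

Lemma hom_map_faithful X Y (f g : {linear X -> Y}) :
  in_add S X -> (forall u, hom_map f u = hom_map g u) -> forall x, f x = g x.
Proof.
move=> [r [j [p pj]]] fg x; rewrite (pj x) !linear_sum; apply: eq_bigr => i _.
by have := congr1 (fun u => hom_eval u (j i x)) (fg (hom_of (p i))); rewrite !hom_mapE !hom_ofE.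
Qed.

(** A map out of X is determined by its composites with the maps
    p_i : S -> X, on which f prescribes values; linearity of f over End(S) makes
    these values compatible. *)
Lemma hom_map_full X Y (f : {linear hom_module X -> hom_module Y}) :
  in_add S X -> exists g : {linear X -> Y}, forall u, hom_map g u = f u.
Proof.
move=> [r [j [p pj]]].
exists (lin_sum (fun i => hom_eval (f (hom_of (p i))) \o j i)) => u; apply: hom_eval_eq => s.
have [_ _ _ _ phi_surj] := phiP.
have [a aE] := choice (fun i => phi_surj (j i \o hom_eval u : {linear S -> S})).
have uE : u = \sum_i ((a i : A^c) *: hom_of (p i)).
  apply: hom_eval_eq => t; rewrite hom_eval_sum {1}(pj (hom_eval u t)).
  by apply: eq_bigr => i _; rewrite hom_eval_act hom_ofE aE.
rewrite hom_mapE lin_sumE [in RHS]uE linear_sum hom_eval_sum; apply: eq_bigr => i _.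
by rewrite linearZ hom_eval_act aE.
Qed.

Lemma hom_map_in_add X Y : in_add X Y -> in_add (hom_module X) (hom_module Y).
Proof.
case=> r [j [p pj]]; exists r, (fun i => hom_map (j i)), (fun i => hom_map (p i)) => u.
apply: hom_eval_eq => s; rewrite hom_eval_sum {1}(pj (hom_eval u s)).
by apply: eq_bigr => i _; rewrite !hom_mapE.
Qed.

Lemma hom_module_reg : isomorphic (reg A) (hom_module S).
Proof.
have [phi1 phiM phiD phi_inj phi_surj] := phiP.
have e (a : A) : orbit_map (hom_of (idfun : {linear S -> S})) a = hom_of (phi a).
  by apply: hom_eval_eq => s; rewrite orbit_mapE hom_eval_act !hom_ofE.
exists (orbit_map (hom_of (idfun : {linear S -> S}))); apply: bijectiveP => [a b|u].
  rewrite !e => ab; apply: phi_inj => s.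
  by have := congr1 (fun u => hom_eval u s) ab; rewrite !hom_ofE.
have [a aE] := phi_surj (hom_eval u); exists a; rewrite e; apply: hom_eval_eq => s.
by rewrite hom_ofE aE.
Qed.

(** An idempotent endomorphism of S^r, written as a matrix so that functors can
    be applied to its entries, is the projection onto a summand. *)
Lemma split_matrix_idempotent r (eps : 'I_r -> 'I_r -> {linear S -> S}) :
  (forall i m s, \sum_l eps i l (eps l m s) = eps i m s) ->
  exists X (u : 'I_r -> {linear X -> S}) (v : 'I_r -> {linear S -> X}),
    (forall x, x = \sum_i v i (u i x)) /\ forall i l s, u i (v l s) = eps i l s.
Proof.
move=> epsM.
pose E : {linear power r S -> power r S} := power_tuple (fun i => power_cotuple (eps i)).
have [x|X [J [p [pJ Jp]]]] := @split_idempotent _ _ _ E.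
  apply/ffunP => i; rewrite !power_tupleE !power_cotupleE.
  under eq_bigr do rewrite power_tupleE power_cotupleE linear_sum.
  by rewrite exchange_big; apply: eq_bigr => m _; apply: epsM.
exists X, (fun i => power_proj S i \o J), (fun i => p \o power_inj S i); split=> [x|i l s] /=.
  by rewrite -[LHS]pJ {1}[J x]power_sum linear_sum.
rewrite Jp power_tupleE power_cotupleE (bigD1 l) //= big1 ?addr0 => [|m ml].
  by rewrite ffunE eqxx.
by rewrite ffunE (negPf ml) linear0.
Qed.

(** A summand of a power of Hom(S, S) is given by an idempotent matrix with
    entries in End(Hom(S, S)) = End(S); split that matrix over B. *)
Lemma hom_module_essential (N : rmod A) :
  in_add (hom_module S) N -> exists X, isomorphic N (hom_module X).
Proof.
case=> r [j [p pj]].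
have [eps epsE] := choice (fun il => @hom_map_full S S
  (j il.1 \o p il.2 : {linear hom_module S -> hom_module S}) (in_add_refl S)).
have [i m s|X [u [v [vu uv]]]] := @split_matrix_idempotent r (fun i l => eps (i, l)).
  apply: (@hom_map_faithful S S (lin_sum (fun l => eps (i, l) \o eps (l, m))) _ (in_add_refl S)) => w.
  rewrite epsE /= (pj (p m w)) linear_sum.
  transitivity (\sum_l hom_map (eps (i, l)) (hom_map (eps (l, m)) w)).
    by apply: hom_eval_eq => t; rewrite hom_mapE hom_eval_sum; apply: eq_bigr => l _; rewrite !hom_mapE.
  by apply: eq_bigr => l _; rewrite !epsE.
exists X, (lin_sum (fun i => hom_map (v i) \o j i)), (lin_sum (fun i => p i \o hom_map (u i))) => [n|x].
  rewrite lin_sumE [RHS]pj; apply: eq_bigr => i _; rewrite comp_linE; congr (p i _).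
  rewrite lin_sumE linear_sum {2}(pj n) linear_sum; apply: eq_bigr => l _.
  rewrite -[RHS](epsE (i, l)) comp_linE; apply: hom_eval_eq => s; rewrite !hom_mapE; exact: uv.
apply: hom_eval_eq => s; rewrite lin_sumE hom_eval_sum [RHS]vu; apply: eq_bigr => i _.
rewrite comp_linE hom_mapE; congr (v i _).
rewrite [in RHS](vu (hom_eval x s)) lin_sumE !linear_sum hom_eval_sum.
apply: eq_bigr => l _.
have := epsE (i, l) (hom_map (u l) x); rewrite !comp_linE => <-.
by rewrite !hom_mapE uv.
Qed.

(** From here on S is a generator, meaning that B itself is a summand of a power
    of S; X and Y are then arbitrary. *)
Lemma hom_map_faithful_gen X Y (f g : {linear X -> Y}) :
  in_add S (reg B) -> (forall u, hom_map f u = hom_map g u) -> forall x, f x = g x.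
Proof.
move=> [r [j [t tj]]] fg x.
rewrite -(orbit_map1 x) (tj (1 : B)) !linear_sum; apply: eq_bigr => i _.
have := congr1 (fun u => hom_eval u (j i (1 : B))) (fg (hom_of (orbit_map x \o t i : {linear S -> X}))).
by rewrite !hom_mapE !hom_ofE.
Qed.

(** The element x is the map a |-> x a from B to X, and B is a summand of a power
    of S by maps t_i : S -> B and j_i : B -> S.  So g x has to be the sum over i
    of f (x t_i) (j_i 1). *)
Lemma hom_map_full_gen X Y (f : {linear hom_module X -> hom_module Y}) :
  in_add S (reg B) -> exists g : {linear X -> Y}, forall u, hom_map g u = f u.
Proof.
move=> [r [j [t tj]]].
have [_ _ _ _ phi_surj] := phiP.
pose w x i : hom_module X := hom_of (orbit_map x \o t i : {linear S -> X}).
pose g x := \sum_i hom_eval (f (w x i)) (j i (1 : B)).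
(* g is compatible with all u : S -> X; linearity over B follows, since X is
   generated by the images of such u. *)
have gU (u : {linear S -> X}) s : g (u s) = hom_eval (f (hom_of u)) s.
  rewrite -{2}(orbit_map1 s) (tj (1 : B)) !linear_sum; apply: eq_bigr => i _.
  have [a aE] := phi_surj (orbit_map s \o t i : {linear S -> S}).
  have -> : w (u s) i = (a : A^c) *: hom_of u.
    by apply: hom_eval_eq => q; rewrite hom_eval_act !hom_ofE aE /= linearZ.
  by rewrite linearZ hom_eval_act aE.
have gD x y : g (x + y) = g x + g y.
  rewrite -big_split; apply: eq_bigr => i _ /=; rewrite -hom_evalD -linearD.
  by congr (hom_eval (f _) _); apply: hom_eval_eq => q; rewrite hom_evalD !hom_ofE /= scalerDr.
have g0 : g 0 = 0 by apply: (@addrI _ (g 0)); rewrite -gD !addr0.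
have gsum (F : 'I_r -> X) : g (\sum_i F i) = \sum_i g (F i).
  by elim/big_rec2: _ => // i x y _ <-; rewrite gD.
have gZ (a : B^c) x : g (a *: x) = a *: g x.
  have -> : a *: x = \sum_i (orbit_map x \o t i : {linear S -> X}) (j i (a : B)).
    by rewrite -[LHS]/(orbit_map x (a : B)) {1}(tj (a : B)) linear_sum.
  rewrite gsum scaler_sumr; apply: eq_bigr => i _.
  by rewrite gU (reg_mapE (j i)) linearZ.
have lin : linear g by move=> a x y; rewrite gD gZ.
exists (linear_of lin) => u; apply: hom_eval_eq => s.
by rewrite hom_mapE -[LHS]/(g (hom_eval u s)) gU hom_evalK.
Qed.

End FullyFaithful.

Lemma in_add_iso (k : closedFieldType) (L : falgType k) (U V X : rmod L) :
  isomorphic U V -> in_add U X -> in_add V X.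
Proof. by move=> /iso_retract/retract_in_add UV UX; apply: in_add_trans UX UV. Qed.

(** * Progenerators *)

Section Morita.
Variables (k : closedFieldType) (L A : falgType k) (P : rmod L).
Variables (phi : A -> {linear P -> P}).
Hypothesis phiP : is_endomorphism_algebra phi.
Hypotheses (P_gen : in_add P (reg L)) (P_proj : in_add (reg L) P).

Local Notation F := (hom_module phiP).
Local Notation Fmap := (hom_map phiP).
Local Notation P' := (F (reg L)).

(** The quasi-inverse of F = Hom_L(P, -) is of the same kind: it is
    G = Hom_A(P', -) for P' = F(L), whose endomorphism algebra is again L
    because F is fully faithful. *)
Definition reg_endo (a : L) : {linear P' -> P'} :=
  Fmap (orbit_map (a : reg L) : {linear reg L -> reg L}).

Lemma reg_endoP : is_endomorphism_algebra reg_endo.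
Proof.
split=> [u|a b u|c a b u|a b ab|f].
- by apply: hom_eval_eq => s; rewrite hom_mapE orbit_mapE regE mul1r.
- by apply: hom_eval_eq => s; rewrite !hom_mapE !orbit_mapE !regE mulrA.
- apply: hom_eval_eq => s; rewrite hom_evalD hom_eval_kscale !hom_mapE !orbit_mapE !regE.
  by rewrite action_module_kscale mulrDl scalerAl.
- have := hom_map_faithful_gen P_gen ab (1 : L).
  by rewrite !orbit_mapE !regE !mulr1.
have [g gE] := hom_map_full_gen f P_gen; exists (g (1 : L)) => u.
rewrite -gE; apply: hom_eval_eq => s; rewrite !hom_mapE.
by rewrite [RHS](reg_mapE g) orbit_mapE.
Qed.

Local Notation G := (hom_module reg_endoP).
Local Notation Gmap := (hom_map reg_endoP).

Lemma unit_linear (X : rmod L) :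
  linear (fun x : X => hom_of reg_endoP (Fmap (orbit_map x)) : G (F X)).
Proof.
move=> a x y; apply: hom_eval_eq => u; rewrite hom_evalD hom_eval_act !hom_ofE.
apply: hom_eval_eq => s; rewrite hom_evalD !hom_mapE !orbit_mapE regE scalerDr scalerA.
by congr (_ + _).
Qed.

Definition unit_map (X : rmod L) : {linear X -> G (F X)} := linear_of (@unit_linear X).
Arguments unit_map {X}.

Lemma unit_mapE (X : rmod L) (x : X) u : hom_eval (unit_map x) u = Fmap (orbit_map x) u.
Proof. exact: hom_ofE. Qed.

Lemma unit_bij (X : rmod L) : bijective (@unit_map X).
Proof.
apply: bijectiveP => [|g].
  apply/inj0P => x x0.
  have x0' u : Fmap (orbit_map x) u = Fmap (\0 : {linear reg L -> X}) u.
    rewrite -unit_mapE x0 hom_eval0; apply: hom_eval_eq => s; rewrite hom_mapE hom_eval0; reflexivity.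
  by rewrite -(orbit_map1 x) (hom_map_faithful_gen P_gen x0').
have [f fE] := hom_map_full_gen (hom_eval g) P_gen.
exists (f (1 : L)); apply: hom_eval_eq => u; rewrite unit_mapE -fE.
by apply: hom_eval_eq => s; rewrite !hom_mapE [RHS]reg_mapE.
Qed.

Lemma unit_nat (X Y : rmod L) (f : {linear X -> Y}) x :
  unit_map (f x) = Gmap (Fmap f) (unit_map x).
Proof.
apply: hom_eval_eq => u; rewrite hom_mapE !unit_mapE.
by apply: hom_eval_eq => s; rewrite !hom_mapE !orbit_mapE linearZ.
Qed.

(** Both F and G are fully faithful because P and P' are generators, and
    G F = 1 by unit_bij.  The counit F G N -> N is the map that G sends to the
    inverse of the unit at G N, so the triangle identity is its definition and
    the remaining properties are checked after applying the faithful G. *)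
Lemma Morita_progenerator : Morita_equivalent L A.
Proof.
have P'_gen : in_add P' (reg A).
  have /iso_retract/retract_in_add A_P := hom_module_reg phiP.
  exact: in_add_trans A_P (hom_map_in_add phiP P_proj).
have counit (N : rmod A) : { eps : {linear F (G N) -> N} |
    (forall g, unit_map (Gmap eps g) = g) /\ (forall g, Gmap eps (unit_map g) = g) }.
  apply: cid; have [t [etaK tK]] := inv_linear (unit_bij (G N)).
  have [eps epsE] := hom_map_full_gen t P'_gen.
  by exists eps; split=> g; rewrite epsE.
pose eps N := sval (counit N); pose eps1 N := (svalP (counit N)).1.
pose eps2 N := (svalP (counit N)).2.
exists (hom_functor phiP), (hom_functor reg_endoP), (@unit_map), eps; split.
- exact: unit_bij.
- move=> X Y f x; exact: unit_nat.
- move=> N; have [t tE] := hom_map_full_gen (unit_map (X := G N)) P'_gen.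
  exists t => x.
    apply: (@hom_map_faithful_gen _ _ _ _ _ reg_endoP _ _
      (t \o eps N : {linear F (G N) -> F (G N)}) idfun P'_gen) => u.
    transitivity (Gmap t (Gmap (eps N) u)).
      by apply: hom_eval_eq => s; rewrite !hom_mapE.
    by rewrite tE eps1; apply: hom_eval_eq => s; rewrite hom_mapE.
  apply: (@hom_map_faithful_gen _ _ _ _ _ reg_endoP _ _ (eps N \o t : {linear N -> N}) idfun P'_gen) => u.
  transitivity (Gmap (eps N) (Gmap t u)).
    by apply: hom_eval_eq => s; rewrite !hom_mapE.
  by rewrite tE eps2; apply: hom_eval_eq => s; rewrite hom_mapE.
- move=> M N f y.
  apply: (@hom_map_faithful_gen _ _ _ _ _ reg_endoP _ _ (f \o eps M : {linear F (G M) -> N})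
    (eps N \o Fmap (Gmap f) : {linear F (G M) -> N}) P'_gen) => u.
  transitivity (Gmap f (Gmap (eps M) u)).
    by apply: hom_eval_eq => s; rewrite !hom_mapE.
  transitivity (Gmap (eps N) (Gmap (Fmap (Gmap f)) u)); last first.
    by apply: hom_eval_eq => s; rewrite !hom_mapE.
  set w := Gmap (eps M) u.
  have -> : u = unit_map w by rewrite eps1.
  by rewrite -unit_nat eps2.
Qed.

End Morita.

(** * From a module with all modules as summands to an Auslander algebra *)

Section EndomorphismImage.
Variables (k : closedFieldType) (L B : falgType k) (S : rmod B).
Variables (phi : L -> {linear S -> S}).
Hypothesis phiP : is_endomorphism_algebra phi.

(** The functor Hom_B(S, -) is fully faithful on U. *)
Lemma hom_module_endomorphism_algebra (A : falgType k) (U : rmod B)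
    (theta : A -> {linear U -> U}) :
  in_add S U -> is_endomorphism_algebra theta ->
  is_endomorphism_algebra (fun a => hom_map phiP (theta a)).
Proof.
move=> SU [th1 thM thD th_inj th_surj].
split=> [u|a b u|c a b u|a b ab|f].
- by apply: hom_eval_eq => s; rewrite hom_mapE th1.
- by apply: hom_eval_eq => s; rewrite !hom_mapE thM.
- by apply: hom_eval_eq => s; rewrite hom_evalD hom_eval_kscale !hom_mapE thD.
- by apply: th_inj; apply: hom_map_faithful ab.
have [g gE] := hom_map_full f SU; have [a aE] := th_surj g.
by exists a => u; rewrite -gE; apply: hom_eval_eq => s; rewrite !hom_mapE aE.
Qed.

Lemma endo_nonzero : ~ zero_mod S.
Proof.
move=> S0; have [_ _ _ phi_inj _] := phiP.
have /eqP : (1 : L) = 0 by apply: phi_inj => s; rewrite (S0 (phi 1 s)) (S0 (phi 0 s)).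
by rewrite oner_eq0.
Qed.

End EndomorphismImage.

Section Basic.
Variables (k : closedFieldType) (B : falgType k).
Implicit Types M N P Q I U V W X Y Z K : rmod B.

Lemma retract_trans X Y Z : retract X Y -> retract Y Z -> retract X Z.
Proof.
case=> j [p pj] [l [q ql]]; exists (l \o j), (p \o q) => x.
by rewrite !comp_linE ql pj.
Qed.

(** Keep one indecomposable summand of S from each isomorphism class; U is cut
    out of S^r by the diagonal matrix of the corresponding idempotents. *)
Lemma basic_generator S : (forall X, in_add S X) ->
  exists n (M : 'I_n -> rmod B) U,
    [/\ complete_indecomposables M, direct_sum M U & in_add U S].
Proof.
move=> S_gen; have [I [N [j [p [N_indec pj s]]]]] := indec_decomposition S.
pose isoN a : pred I := fun b => `[< isomorphic (N a) (N b) >].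
(* pick only depends on the extension of its predicate, so rep is constant on
   isomorphism classes. *)
pose rep a := odflt a [pick b | isoN a b].
have isoN_rep a : isomorphic (N a) (N (rep a)).
  by rewrite /rep; case: pickP => [b /asboolP //|_]; apply: isomorphic_refl.
have rep_eq a b : isomorphic (N a) (N b) -> rep a = rep b.
  move=> ab; have e : isoN a =1 isoN b.
    move=> c; apply/asboolP/asboolP; last exact: isomorphic_trans.
    by apply: isomorphic_trans; apply: isomorphic_sym.
  rewrite /rep (eq_pick e); case: pickP => //= /(_ b).
  by have -> : isoN b b by apply/asboolP/isomorphic_refl.
pose J : {set I} := [set a | rep a == a].
have repJ a : rep a \in J by rewrite inE; apply/eqP/esym/rep_eq/isoN_rep.
pose r := #|J|; pose ev (a : 'I_r) : I := enum_val a.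
have evJ a : rep (ev a) = ev a by have := enum_valP a; rewrite inE => /eqP.
pose eps (a b : 'I_r) : {linear S -> S} :=
  if a == b then (j (ev a) \o p (ev a) : {linear S -> S})
  else (\0 : {linear S -> S}).
have [a c x|U [u [v [vu uv]]]] := @split_matrix_idempotent _ _ S r eps.
  rewrite (bigD1 a) //= big1 ?addr0 => [|b ba]; last by rewrite /eps eq_sym (negPf ba).
  rewrite /eps eqxx; have [_|_] := boolP (a == c); last by rewrite linear0.
  by rewrite !comp_linE pj.
pose inj a : {linear N (ev a) -> U} := v a \o j (ev a).
pose proj a : {linear U -> N (ev a)} := p (ev a) \o u a.
have proj_inj a x : proj a (inj a x) = x.
  by rewrite !comp_linE uv /eps eqxx /= !pj.
exists r, (fun a => N (ev a)), U; split.
- split=> [a|a b ab|X X_indec]; first exact: N_indec.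
    by apply: enum_val_inj; rewrite -[LHS]evJ -[RHS]evJ; apply: rep_eq.
  have [t [l [q ql]]] := S_gen X.
  have [||[m a]] := @indec_summand _ _ X ('I_t * I)%type (fun c => N c.2)
    (fun c => p c.2 \o l c.1) (fun c => q c.1 \o j c.2) X_indec.
  + by move=> c; apply: N_indec.
  + move=> x; rewrite -(pair_bigA _ (fun a b => q a (j b (p b (l a x))))) /= {1}(ql x).
    by apply: eq_bigr => a _; rewrite {1}(s (l a x)) linear_sum.
  move=> /= Xa; exists (enum_rank_in (repJ a) (rep a)); rewrite /ev enum_rankK_in //.
  exact: isomorphic_trans Xa (isoN_rep a).
- exists inj, proj; split=> [|a b x ab|x]; first exact: proj_inj.
    by rewrite !comp_linE uv /eps eq_sym (negPf ab) /= linear0.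
  rewrite {1}(vu x); apply: eq_bigr => a _; rewrite !comp_linE.
  congr (v a _); rewrite [in LHS](vu x) linear_sum.
  rewrite (bigD1 a) //= big1 ?addr0 => [|b ba]; first by rewrite uv /eps eqxx.
  by rewrite uv /eps eq_sym (negPf ba).
have ret a : exists io : {linear N a -> U} * {linear U -> N a}, forall x, io.2 (io.1 x) = x.
  have : retract (N a) U.
    apply: retract_trans (iso_retract (isoN_rep a)) _.
    rewrite -(enum_rankK_in (repJ a) (repJ a)).
    by exists (inj (enum_rank_in (repJ a) (rep a))), (proj _); apply: proj_inj.
  by case=> i [o oi]; exists (i, o).
have io a := cid (ret a).
apply: (@in_add_finType _ _ I U S (fun a => (sval (io a)).1 \o p a)
  (fun a => j a \o (sval (io a)).2)) => x.
by rewrite {1}(s x); apply: eq_bigr => a _; rewrite !comp_linE (svalP (io a)).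
Qed.

End Basic.

Lemma Auslander_algebra_of_generator (k : closedFieldType) (L B : falgType k)
    (S : rmod B) : endomorphism_algebra L S -> (forall X, in_add S X) ->
  Auslander_algebra L.
Proof.
move=> [phi phiP] S_gen.
have [n [M [U [M_complete M_sum U_gen]]]] := basic_generator S_gen.
have U_nz : ~ zero_mod U.
  move=> U0; apply: (endo_nonzero phiP) => x; have [r [j [p pj]]] := U_gen.
  by rewrite (pj x) big1 // => i _; rewrite (U0 (j i x)) linear0.
exists B, (endo_type U_nz); split.
  exists n, M, U; split=> //; exists (fun f => hom_fun f); exact: endo_algebraP.
apply: (Morita_progenerator
  (hom_module_endomorphism_algebra phiP (S_gen U) (endo_algebraP U_nz))).
  have /iso_retract/retract_in_add A_P := hom_module_reg phiP.
  exact: in_add_trans A_P (hom_map_in_add phiP U_gen).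
exact: in_add_iso (isomorphic_sym (hom_module_reg phiP)) (hom_map_in_add phiP (S_gen U)).
Qed.

(** * From an Auslander algebra to a module with all modules as summands *)

Section Equivalences.
Variables (k : closedFieldType) (A B : falgType k).

Definition faithful (F : klinear_functor A B) := forall (X Y : rmod A)
  (f g : {linear X -> Y}), fmap F f =1 fmap F g -> f =1 g.
Definition full (F : klinear_functor A B) := forall (X Y : rmod A)
  (f : {linear F X -> F Y}), exists g : {linear X -> Y}, fmap F g =1 f.
Definition dense (F : klinear_functor A B) := forall Z : rmod B,
  exists Y : rmod A, isomorphic Z (F Y).

Section Functor.
Variable F : klinear_functor A B.
Implicit Types X Y Z P : rmod A.

Lemma fmapI X y : fmap F (idfun : {linear X -> X}) y = y.
Proof. exact: (@fmap_id _ _ _ F X idfun (frefl _)). Qed.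

Lemma fmapC X Y Z (f : {linear X -> Y}) (g : {linear Y -> Z}) y :
  fmap F (g \o f : {linear X -> Z}) y = fmap F g (fmap F f y).
Proof. exact: (@fmap_comp _ _ _ F X Y Z f g (g \o f) (frefl _)). Qed.

Lemma fmapD X Y (f g h : {linear X -> Y}) :
  (forall x, h x = f x + g x) -> forall y, fmap F h y = fmap F f y + fmap F g y.
Proof.
move=> hE y; rewrite (@fmap_linear _ _ _ F _ _ 1 f g).
  by rewrite /kscale !scale1r.
by move=> x; rewrite /kscale !scale1r.
Qed.

(** The zero map is its own double; fmap_linear is used with coefficient 1. *)
Lemma fmap0 X Y (h : {linear X -> Y}) :
  (forall x, h x = 0) -> forall y, fmap F h y = 0.
Proof.
move=> h0 y; apply: (@addrI _ (fmap F h y)); rewrite addr0 -(@fmapD _ _ h h h) // => x.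
by rewrite !h0 addr0.
Qed.

Lemma fmap_ext X Y (f g : {linear X -> Y}) : f =1 g -> fmap F f =1 fmap F g.
Proof.
move=> fg y; rewrite (@fmapD _ _ g (\0 : {linear X -> Y}) f) => [|x]; last by rewrite fg addr0.
by rewrite [X in _ + X]fmap0 ?addr0.
Qed.

Lemma fmap_sum I (r : seq I) X Y (f : I -> {linear X -> Y}) (h : {linear X -> Y}) :
  (forall x, h x = \sum_(i <- r) f i x) ->
  forall y, fmap F h y = \sum_(i <- r) fmap F (f i) y.
Proof.
elim: r h => [|i r IHr] h hE y.
  by rewrite big_nil; apply: fmap0 => x; rewrite hE big_nil.
have lin : linear (fun x => \sum_(j <- r) f j x).
  by move=> a u v; rewrite scaler_sumr -big_split; apply: eq_bigr => j _; rewrite linearP.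
rewrite big_cons -(IHr (linear_of lin)) //; apply: fmapD => x.
by rewrite hE big_cons.
Qed.

Lemma fmap_in_add X Y : in_add X Y -> in_add (F X) (F Y).
Proof.
case=> r [j [p pj]]; exists r, (fun i => fmap F (j i)), (fun i => fmap F (p i)) => y.
rewrite -[LHS]fmapI (@fmap_sum _ _ _ _ (fun i => p i \o j i) idfun pj).
by apply: eq_bigr => i _; rewrite fmapC.
Qed.

Hypotheses (Ff : faithful F) (Fu : full F) (Fd : dense F).

(** Surjections are epimorphisms, tested on the quotient by the image; density
    and fullness bring that test back to the source category. *)
Lemma fmap_surj X Y (g : {linear X -> Y}) : surj g -> surj (fmap F g).
Proof.
move=> g_surj y.
have [Z [p [p_surj p0]]] := quotmodP (image_submodule (fmap F g)).
apply/p0; have [W [e [e' eK _]]] := Fd Z.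
have [w wE] := Fu (e \o p : {linear F Y -> F W}).
apply: (can_inj eK); rewrite -[LHS]/((e \o p) y) -wE linear0.
apply: fmap0 => y'; have [x <-] := g_surj y'.
suff e0 : (w \o g : {linear X -> W}) =1 (\0 : {linear X -> W}) by exact: (e0 x).
apply: Ff => u; rewrite [RHS]fmap0 //.
rewrite fmapC wE comp_linE.
by have -> : p (fmap F g u) = 0; [apply/p0; exists u | rewrite linear0].
Qed.

Lemma fmap_reflects_projective P : projective (F P) -> projective P.
Proof.
move=> FPp X Y g f g_surj.
have [h hE] := FPp _ _ (fmap F g) (fmap F f) (fmap_surj g_surj).
have [t tE] := Fu h; exists t => x.
suff e : (g \o t : {linear P -> Y}) =1 f by exact: e.
apply: Ff => u; rewrite fmapC tE; exact: hE.
Qed.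

End Functor.
End Equivalences.

Section MoritaData.
Variables (k : closedFieldType) (A B : falgType k).

Lemma fmap_faithful (F : klinear_functor A B) (G : klinear_functor B A)
    (eta : forall M : rmod A, {linear M -> G (F M)}) :
  (forall M : rmod A, bijective (eta M)) ->
  (forall (M N : rmod A) (f : {linear M -> N}) x,
     eta N (f x) = fmap G (fmap F f) (eta M x)) -> faithful F.
Proof.
move=> eta_bij eta_nat X Y f g fg x.
apply: (bij_inj (eta_bij Y)); rewrite !eta_nat; exact: fmap_ext.
Qed.

Lemma fmap_full (F : klinear_functor A B) (G : klinear_functor B A)
    (eta : forall M : rmod A, {linear M -> G (F M)}) :
  (forall M : rmod A, bijective (eta M)) ->
  (forall (M N : rmod A) (f : {linear M -> N}) x,
     eta N (f x) = fmap G (fmap F f) (eta M x)) -> faithful G -> full F.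
Proof.
move=> eta_bij eta_nat Gf X Y f.
have [t [tK Kt]] := inv_linear (eta_bij Y).
exists (t \o fmap G f \o eta X : {linear X -> Y}).
apply: Gf => u; have [x <-] := bij_surj (eta_bij X) u.
by rewrite -eta_nat /= Kt.
Qed.

End MoritaData.

(** The data of a Morita equivalence are symmetric once the counit is inverted,
    so both functors are fully faithful and dense. *)
Lemma Morita_functors (k : closedFieldType) (A B : falgType k) :
  Morita_equivalent A B -> exists (F : klinear_functor A B) (G : klinear_functor B A),
    [/\ [/\ faithful F, full F & dense F], [/\ faithful G, full G & dense G],
        forall M : rmod A, isomorphic M (G (F M)) & forall N : rmod B, isomorphic N (F (G N))].
Proof.
case=> F [G [eta [eps [eta_bij eta_nat eps_bij eps_nat]]]]; exists F, G.
have epsV N := cid (inv_linear (eps_bij N)).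
pose eps' N := sval (epsV N).
have eps'_bij N : bijective (eps' N) by have [K1 K2] := svalP (epsV N); exists (eps N).
have eps'_nat (M N : rmod B) (f : {linear M -> N}) x :
    eps' N (f x) = fmap F (fmap G f) (eps' M x).
  have [K1 K2] := svalP (epsV N); apply: (can_inj K1); rewrite K2 -eps_nat.
  by have [K1' K2'] := svalP (epsV M); rewrite K2'.
have Ff := fmap_faithful eta_bij eta_nat; have Gf := fmap_faithful eps'_bij eps'_nat.
split.
- split=> // [|Z]; first exact: fmap_full eta_bij eta_nat Gf.
  by exists (G Z), (eps' Z).
- split=> // [|Z]; first exact: fmap_full eps'_bij eps'_nat Ff.
  by exists (F Z), (eta Z).
- by move=> M; exists (eta M).
- by move=> N; exists (eps' N).
Qed.

(** This is where finite representation type is used: each indecomposable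
    summand of X is one of the M_i. *)
Lemma complete_generator (k : closedFieldType) (B : falgType k) n
    (M : 'I_n -> rmod B) S :
  complete_indecomposables M -> direct_sum M S -> forall X, in_add S X.
Proof.
move=> [_ _ M_all] [inj [proj [proj_inj _ _]]] X.
have [I [N [j [p [N_indec pj s]]]]] := indec_decomposition X.
have ret i : exists io : {linear N i -> S} * {linear S -> N i}, forall x, io.2 (io.1 x) = x.
  have [a Na] := M_all _ (N_indec i).
  have [l [q ql]] : retract (N i) S.
    by apply: retract_trans (iso_retract Na) _; exists (inj a), (proj a).
  by exists (l, q).
have io i := cid (ret i).
apply: (@in_add_finType _ _ I S X (fun a => (sval (io a)).1 \o p a)
  (fun a => j a \o (sval (io a)).2)) => x.
by rewrite {1}(s x); apply: eq_bigr => a _; rewrite !comp_linE (svalP (io a)).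
Qed.

Lemma endomorphism_algebra_iso (k : closedFieldType) (L A : falgType k) (M N : rmod A) :
  isomorphic M N -> endomorphism_algebra L M -> endomorphism_algebra L N.
Proof.
case=> f /inv_linear[g [fK gK]] [phi [phi1 phiM phiD phi_inj phi_surj]].
exists (fun a => f \o phi a \o g : {linear N -> N}).
split=> [x|a b x|c a b x|a b ab|h] /=.
- by rewrite phi1 gK.
- by rewrite phiM fK.
- by rewrite phiD linearD linear_kscale.
- apply: phi_inj => x; apply: (can_inj fK).
  by have := ab (f x); rewrite /= fK.
have [a aE] := phi_surj (g \o h \o f : {linear M -> M}); exists a => x.
by rewrite /= aE /= !gK.
Qed.

Section Descent.
Variables (k : closedFieldType) (A B L : falgType k) (S : rmod B).
Variables (phi : A -> {linear S -> S}).
Hypothesis phiP : is_endomorphism_algebra phi.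

(** Full faithfulness of Hom_B(S, -) reflects the relation in_add. *)
Lemma in_add_descent S' X : in_add S S' -> in_add S X ->
  in_add (hom_module phiP S') (hom_module phiP X) -> in_add S' X.
Proof.
move=> SS' SX [r [j [p pj]]].
have [j' jE] := choice (fun i => hom_map_full (j i) SX).
have [p' pE] := choice (fun i => hom_map_full (p i) SS').
exists r, j', p' => x.
suff e : forall u, hom_map phiP (idfun : {linear X -> X}) u
    = hom_map phiP (lin_sum (fun i => p' i \o j' i)) u.
  exact: (hom_map_faithful SX e).
move=> u; apply: hom_eval_eq => s; rewrite !hom_mapE lin_sumE {1}(pj u) hom_eval_sum.
by apply: eq_bigr => i _; rewrite -jE -pE !hom_mapE.
Qed.

Lemma endomorphism_descent S' : in_add S S' ->
  endomorphism_algebra L (hom_module phiP S') -> endomorphism_algebra L S'.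
Proof.
move=> SS' [tau [tau1 tauM tauD tau_inj tau_surj]].
have [sigma sigmaE] := choice (fun a => hom_map_full (tau a) SS').
exists sigma; split=> [x|a b x|c a b x|a b ab|f].
- suff e : forall u, hom_map phiP (sigma 1) u = hom_map phiP (idfun : {linear S' -> S'}) u.
    exact: (hom_map_faithful SS' e).
  by move=> u; rewrite sigmaE tau1; apply: hom_eval_eq => s; rewrite hom_mapE.
- suff e : forall u, hom_map phiP (sigma (a * b)) u
      = hom_map phiP (sigma a \o sigma b : {linear S' -> S'}) u.
    exact: (hom_map_faithful SS' e).
  move=> u; rewrite sigmaE tauM; apply: hom_eval_eq => s; rewrite !hom_mapE -!sigmaE !hom_mapE; reflexivity.
- pose h : homspace S' S' := c *: hom_mk (sigma a) + hom_mk (sigma b).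
  have hE y : hom_fun h y = kscale c (sigma a y) + sigma b y by rewrite hom_funP !hom_mkE.
  suff e : forall u, hom_map phiP (sigma (c *: a + b)) u = hom_map phiP (hom_fun h) u.
    by rewrite (hom_map_faithful SS' e) hE.
  move=> u; rewrite sigmaE tauD; apply: hom_eval_eq => s.
  by rewrite hom_evalD hom_eval_kscale -!sigmaE !hom_mapE hE.
- apply: tau_inj => u; rewrite -!sigmaE; apply: hom_eval_eq => s.
  by rewrite !hom_mapE ab.
have [a aE] := tau_surj (hom_map phiP f); exists a.
by apply: (hom_map_faithful (phiP := phiP) SS') => u; rewrite sigmaE aE.
Qed.

End Descent.

Lemma reg_endomorphism_algebra (k : closedFieldType) (L : falgType k) :
  endomorphism_algebra L (reg L).
Proof.
exists (fun a => orbit_map (a : reg L)); split=> [s|a b s|c a b s|a b ab|f].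
- by rewrite orbit_mapE regE mul1r.
- by rewrite !orbit_mapE !regE mulrA.
- by rewrite !orbit_mapE !regE action_module_kscale mulrDl scalerAl.
- by have := ab (1 : L); rewrite !orbit_mapE !regE !mulr1.
by exists (f (1 : L)) => s; rewrite [RHS]reg_mapE orbit_mapE.
Qed.

Lemma fmap_endomorphism_algebra (k : closedFieldType) (A B L : falgType k)
    (F : klinear_functor A B) (M : rmod A) : faithful F -> full F ->
  endomorphism_algebra L M -> endomorphism_algebra L (F M).
Proof.
move=> Ff Fu [phi [phi1 phiM phiD phi_inj phi_surj]].
exists (fun a => fmap F (phi a)); split=> [s|a b s|c a b s|a b ab|f].
- by rewrite -[RHS]fmapI; apply: fmap_ext.
- by rewrite -fmapC; apply: fmap_ext => x; apply: phiM.
- by apply: fmap_linear => x; apply: phiD.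
- by apply: phi_inj; apply: Ff.
have [g gE] := Fu _ _ f; have [a aE] := phi_surj g; exists a => s.
by rewrite -gE; apply: fmap_ext.
Qed.

(** The equivalence F sends L to a projective A-module T such that A is a summand
    of a power of T, because F and G reflect projectivity.  As
    A = Hom_B(S, S), T is Hom_B(S, S') with S' a summand of a power of S and
    conversely. *)
Lemma generator_of_Auslander_algebra (k : closedFieldType) (L : falgType k) :
  Auslander_algebra L -> exists (B : falgType k) (S : rmod B),
    endomorphism_algebra L S /\ forall X, in_add S X.
Proof.
case=> B [A [[n [M [S [M_complete M_sum [phi phiP]]]]] /Morita_functors]].
case=> F [G [[Ff Fu Fd] [Gf Gu Gd] GF FG]].
have S_gen := complete_generator M_complete M_sum.
have T_proj : projective (F (reg L)).
  apply: (fmap_reflects_projective Gf Gu Gd).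
  exact: iso_projective (isomorphic_sym (GF _)) (@reg_projective _ _).
have GA_proj : projective (G (reg A)).
  apply: (fmap_reflects_projective Ff Fu Fd).
  exact: iso_projective (isomorphic_sym (FG _)) (@reg_projective _ _).
have T_A : in_add (hom_module phiP S) (F (reg L)).
  by apply: in_add_iso (hom_module_reg phiP) _; apply/projectiveP.
have A_T : in_add (F (reg L)) (hom_module phiP S).
  have A_T : in_add (F (reg L)) (F (G (reg A))) by apply/fmap_in_add/projectiveP.
  apply: in_add_trans A_T; apply/retract_in_add/iso_retract.
  exact: isomorphic_trans (isomorphic_sym (hom_module_reg phiP)) (FG _).
have [S' TS'] := hom_module_essential T_A.
exists B, S'; split.
  apply: (endomorphism_descent (phiP := phiP) (S_gen S')).
  apply: (@endomorphism_algebra_iso _ _ _ (F (reg L)) (hom_module phiP S') TS').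
  exact/fmap_endomorphism_algebra/reg_endomorphism_algebra.
move=> X; apply: in_add_trans (S_gen X) _; apply: (in_add_descent (phiP := phiP)) => //.
exact: in_add_iso TS' A_T.
Qed.

(** * The torsion pair of an Auslander algebra *)

Section CogeneratedTorsion.
Variables (k : closedFieldType) (L : falgType k).
Implicit Types M N P Q I U V W X Y Z K : rmod L.

Definition cogenerated Q M : Prop :=
  forall x : M, (forall u : {linear M -> Q}, u x = 0) -> x = 0.

Lemma cogenerated_sub Q M N (i : {linear N -> M}) :
  injective i -> cogenerated Q M -> cogenerated Q N.
Proof.
move=> /inj0P i0 M_cog x x0; apply/i0/M_cog => u; exact: (x0 (u \o i : {linear N -> Q})).
Qed.

(** For maximality of the torsion-free class, the intersection K of the kernels
    of all maps N -> Q is torsion: a map K -> Q extends to N and so vanishes on K. *)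
Lemma injective_cogenerates_torsion_pair Q : injective_mod Q ->
  hereditary_torsion_pair (fun M => hom_zero M Q) (cogenerated Q).
Proof.
move=> Qi; split; first split.
- move=> M N [f /inv_linear[g [fK gK]]] M0 u x; rewrite -[x]gK.
  exact: (M0 (u \o f : {linear M -> Q})).
- move=> M N [f /inv_linear[g [fK gK]]]; apply: (cogenerated_sub (i := g)).
  exact: can_inj gK.
- by move=> M N M0 N_cog f x; apply: N_cog => u; exact: (M0 (u \o f : {linear M -> Q})).
- by move=> M M0; apply: M0 => x x0; exact: (x0 (idfun : {linear Q -> Q})).
- move=> N N_tf x x0.
  have sub : submodule (fun x : N => forall u : {linear N -> Q}, u x = 0).
    split=> [u|a y z y0 z0 u]; first by rewrite linear0.
    by rewrite linearP y0 z0 scaler0 addr0.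
  have [K [i [i_inj iP]]] := submodP sub.
  have K0 : hom_zero K Q.
    move=> u y; have [v <-] := Qi _ _ i u i_inj.
    by apply: (proj2 (iP (i y))); exists y.
  have [y <-] := proj1 (iP x) x0; exact: N_tf K0 i y.
- move=> M N i i_inj M0 u x; have [v <-] := Qi _ _ i u i_inj; exact: M0.
Qed.

End CogeneratedTorsion.

Section GeneratorTorsion.
Variables (k : closedFieldType) (L B : falgType k) (S : rmod B).
Variables (phi : L -> {linear S -> S}).
Hypothesis phiP : is_endomorphism_algebra phi.
Hypothesis S_gen : forall X : rmod B, in_add S X.

Implicit Types (X Y Z I U : rmod B) (M : rmod L).
Local Notation h := (hom_module phiP).
Local Notation hm := (hom_map phiP).

Lemma hom_module_projective X : projective (h X).
Proof.
apply/projectiveP/(in_add_iso (isomorphic_sym (hom_module_reg phiP))).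
exact: hom_map_in_add.
Qed.

Lemma hom_module_cover (M : rmod L) : exists X (p : {linear h X -> M}), surj p.
Proof.
have [n [p p_surj]] := reg_cover M.
have [f /inv_linear[g [fK gK]]] := hom_module_reg phiP.
exists (power n S), (p \o power_tuple (fun i => g \o hm (power_proj S i)) : {linear h (power n S) -> M}) => x.
have [c <-] := p_surj x.
exists (hom_of phiP (power_tuple (fun i => hom_eval (f (c i))))); rewrite comp_linE; congr (p _).
apply/ffunP => i; rewrite power_tupleE comp_linE -[RHS]fK; congr (g _).
by apply: hom_eval_eq => s; rewrite hom_mapE hom_ofE power_projE power_tupleE.
Qed.

Lemma hom_map_inj X Y (f : {linear X -> Y}) : injective f -> injective (hm f).
Proof.
move=> f_inj u v fuv; apply: hom_eval_eq => s; apply: f_inj.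
by rewrite -!hom_mapE fuv.
Qed.

Lemma hom_map_lift X Y (i : {linear X -> Y}) u : injective i ->
  (forall s, exists x, i x = hom_eval u s) -> exists v, hm i v = u.
Proof.
move=> i_inj iu; have [v vE] := @factor_inj _ _ _ _ i (hom_eval u) i_inj iu.
by exists (hom_of phiP v); apply: hom_eval_eq => s; rewrite hom_mapE hom_ofE.
Qed.

Lemma hom_map_eq0 X Y (f : {linear X -> Y}) :
  (forall u, hm f u = 0) -> forall x, f x = 0.
Proof.
move=> f0; apply: (@hom_map_faithful _ _ _ _ _ phiP _ _ f \0) => // u.
by rewrite f0; apply: hom_eval_eq => s; rewrite hom_mapE hom_eval0.
Qed.

(** To extend f : X -> h I along g : X -> Y, cover Y by h X_0 and the preimage U
    of X in h X_0 by h X_1.  The composite h X_1 -> U -> X -> h I comes from a map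
    b : X_1 -> I, and b vanishes on the kernel of a : X_1 -> X_0 because h
    preserves kernels.  Injectivity of I extends b along a, and h of the
    extension, which kills the kernel of h X_0 -> Y, factors through Y. *)
Lemma hom_module_injective I : injective_mod I -> injective_mod (h I).
Proof.
move=> Ii X Y g f g_inj.
have [X0 [p p_surj]] := hom_module_cover Y.
have sub : submodule (fun m => exists x, g x = p m).
  split=> [|a m n [x gx] [y gy]]; first by exists 0; rewrite !linear0.
  by exists (a *: x + y); rewrite !linearP gx gy.
have [U [i [i_inj iP]]] := submodP sub.
have [|f' f'E] := @factor_inj _ _ _ _ g (p \o i : {linear U -> Y}) g_inj.
  by move=> x; apply/iP; exists x.
have [X1 [q q_surj]] := hom_module_cover U.
have [a aE] := hom_map_full (i \o q : {linear h X1 -> h X0}) (S_gen X1).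
have [b bE] := hom_map_full (f \o f' \o q : {linear h X1 -> h I}) (S_gen X1).
have [|c cE] := @injective_factor _ _ I _ _ a b Ii.
  move=> x ax; have [K [ka [_ kaP]]] := submodP (kernel_submodule a).
  have /kaP[y <-] := ax.
  apply: (@hom_map_eq0 K I (b \o ka : {linear K -> I})) => u.
  have -> : hm (b \o ka : {linear K -> I}) u = hm b (hm ka u).
    by apply: hom_eval_eq => s; rewrite !hom_mapE.
  rewrite bE !comp_linE.
  have -> : q (hm ka u) = 0; last by rewrite !linear0.
  have /inj0P i0 := i_inj; apply: i0.
  have := aE (hm ka u); rewrite comp_linE => <-.
  apply: hom_eval_eq => s; rewrite !hom_mapE hom_eval0.
  by apply/kaP; exists (hom_eval u s).
have cf m : hm c (i m) = f (f' m).
  have [v <-] := q_surj m.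
  have := aE v; rewrite comp_linE => <-.
  have := bE v; rewrite !comp_linE => <-.
  by apply: hom_eval_eq => s; rewrite !hom_mapE cE.
have f'i m x : p (i m) = g x -> f' m = x.
  by move=> pm; apply: g_inj; rewrite f'E.
have [|d dE] := @factor_surj _ _ _ _ p (hm c) p_surj.
  move=> m pm; have /iP[m' im'] : exists x, g x = p m by exists 0; rewrite pm linear0.
  by rewrite -im' cf (f'i _ 0) ?linear0 // im'.
exists d => x; have [m pm] := p_surj (g x).
have /iP[m' im'] : exists x, g x = p m by exists x.
by rewrite -pm dE -im' cf (f'i _ x) // im'.
Qed.

Let Q := h (coreg B).

(** M is the cokernel of h a for some injective a : X_1 -> X_0; with Y the cokernel
    of a, left exactness of h makes the induced map M -> h Y injective. *)
Lemma pd_le1_embeds M : pd_le M 1 -> exists Y (i : {linear M -> h Y}), injective i.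
Proof.
move=> pdM.
have [X0 [p p_surj]] := hom_module_cover M.
have [K [i [i_inj iP]]] := submodP (kernel_submodule p).
have K_proj : projective K.
  exact: (kernel_projective pdM (@hom_module_projective X0) p_surj i_inj iP).
have [X1 [f f_bij]] : exists X, isomorphic (h X) K.
  have [X KX] := @hom_module_essential _ _ _ _ _ phiP K
    (in_add_iso (hom_module_reg phiP) (proj1 (projectiveP K) K_proj)).
  by exists X; apply: isomorphic_sym.
have [a aE] := hom_map_full (i \o f : {linear h X1 -> h X0}) (S_gen X1).
have a_inj : injective a.
  apply/inj0P => x ax; have [Z [ka [ka_inj kaP]]] := submodP (kernel_submodule a).
  have /kaP[y <-] := ax.
  apply: (hom_map_eq0 (f := ka)) => u.
  apply: (bij_inj f_bij); apply: i_inj; have := aE (hm ka u).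
  rewrite comp_linE => <-; rewrite !linear0; apply: hom_eval_eq => s.
  by rewrite !hom_mapE hom_eval0; apply/kaP; exists (hom_eval u s).
have [Y [c [c_surj c0]]] := quotmodP (image_submodule a).
have key m : p m = 0 <-> hm c m = 0.
  split=> [/iP[n <-]|cm].
    have [u <-] := bij_surj f_bij n.
    have := aE u; rewrite comp_linE => <-; apply: hom_eval_eq => s.
    by rewrite !hom_mapE hom_eval0; apply/c0; exists (hom_eval u s).
  have [|u au] := @hom_map_lift _ _ a m a_inj.
    by move=> s; apply/c0; rewrite -hom_mapE cm hom_eval0.
  by apply/iP; exists (f u); rewrite -au aE.
have [|d dE] := @factor_surj _ _ _ _ p (hm c) p_surj; first by move=> x /key.
exists Y, d; apply/inj0P => m; have [x <-] := p_surj m.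
by rewrite dE => /key.
Qed.

Lemma hom_module_cogenerated Y : cogenerated Q (h Y).
Proof.
move=> u u0; apply: hom_eval_eq => s; rewrite hom_eval0; apply: coreg_sep => v.
by have := congr1 (fun w => hom_eval w s) (u0 (hm v)); rewrite hom_mapE hom_eval0.
Qed.

(** The kernel of p : h X_0 -> M is the common kernel of all maps
    h X_0 -> M -> Q; these are of the form h (w_v), so the kernel is h of the
    common kernel of the w_v and hence projective. *)
Lemma cogenerated_pd_le1 M : cogenerated Q M -> pd_le M 1.
Proof.
move=> M_cog; have [X0 [p p_surj]] := hom_module_cover M.
have [w wE] := choice (fun v : {linear M -> Q} =>
  hom_map_full (v \o p : {linear h X0 -> Q}) (S_gen X0)).
have sub : submodule (fun x : X0 => forall v, w v x = 0).
  split=> [v|a x y x0 y0 v]; first by rewrite linear0.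
  by rewrite linearP x0 y0 scaler0 addr0.
have [X1 [i [i_inj iP]]] := submodP sub.
apply/pd_le1P; exists (h X1), (h X0), (hm i), p; split=> //; try exact: hom_module_projective.
  exact: hom_map_inj.
move=> m; split=> [pm|[u <-]].
  apply: hom_map_lift => // s; apply/iP => v.
  have := congr1 (fun z => hom_eval z s) (wE v m).
  by rewrite comp_linE pm linear0 hom_mapE hom_eval0.
apply: M_cog => v; rewrite -[LHS]/((v \o p : {linear h X0 -> Q}) _) -wE.
apply: hom_eval_eq => s; rewrite !hom_mapE hom_eval0.
by have /iP : exists y, i y = i (hom_eval u s) by exists (hom_eval u s).
Qed.

Lemma injective_pd_le1 (I : rmod L) : injective_mod I -> pd_le I 1 -> projective I.
Proof.
move=> Ii /pd_le1_embeds[Y [i i_inj]].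
exact: in_add_projective (@hom_module_projective Y) (retract_in_add (inj_injective Ii i_inj)).
Qed.

Lemma generator_torsion_pair : exists T F : rmod L -> Prop,
    [/\ hereditary_torsion_pair T F,
        forall M : rmod L, pd_le M 1 <-> F M
      & forall I : rmod L,
          indecomposable I -> injective_mod I -> ~ pd_eq I 1].
Proof.
exists (fun M => hom_zero M Q), (cogenerated Q); split.
- exact/injective_cogenerates_torsion_pair/hom_module_injective/coreg_injective.
- move=> M; split=> [/pd_le1_embeds[Y [i i_inj]]|]; last exact: cogenerated_pd_le1.
  exact: cogenerated_sub i_inj (hom_module_cogenerated (Y := Y)).
move=> I _ Ii [pd1 pd0]; apply: (pd0 0%N) => //.
by apply/pd_le0P/injective_pd_le1.
Qed.

End GeneratorTorsion.

(** * Duality and the double centralizer of a projective-injective module *)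

Section LinearAlgebra.
Variable k : fieldType.

Lemma functional_sum (X : vectType k) (xi : 'Hom(X, k^o)) :
  xi = \sum_(i < \dim {:X}) (xi (vbasis {:X})`_i) *: coordf i.
Proof.
apply/lfunP => x; rewrite {1}(coordf_sum x) linear_sum sum_lfunE.
by apply: eq_bigr => i _; rewrite linearZ scale_lfunE [RHS]mulrC.
Qed.

(** Reflexivity of finite-dimensional spaces. *)
Lemma functional_eval (X : vectType k) (eta : 'Hom('Hom(X, k^o), k^o)) :
  exists x, forall xi : 'Hom(X, k^o), eta xi = xi x.
Proof.
exists (\sum_(i < \dim {:X}) eta (coordf i) *: (vbasis {:X})`_i) => xi.
rewrite {1}(functional_sum xi) !linear_sum; apply: eq_bigr => i _.
by rewrite !linearZ [RHS]mulrC.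
Qed.

(** Since zeta vanishes on the kernel of Phi it factors as eta Phi with eta a
    functional on the dual of X, that is, evaluation at a vector. *)
Lemma pairing_represents (X V : vectType k) (Phi : 'Hom(V, 'Hom(X, k^o)))
    (zeta : 'Hom(V, k^o)) :
  (forall b, Phi b = 0 -> zeta b = 0) -> exists x, forall b, Phi b x = zeta b.
Proof.
move=> zeta0; have [x xE] := functional_eval (zeta \o Phi^-1)%VF.
exists x => b; rewrite -xE comp_lfunE; apply/eqP; rewrite -subr_eq0 -linearB.
apply/eqP/zeta0; rewrite linearB.
have /lfunP/(_ b) := inv_lfun_def Phi; rewrite !comp_lfunE => e.
by apply/eqP; rewrite subr_eq0; apply/eqP.
Qed.

Lemma transpose_exists (X : vectType k) (f : 'End('Hom(X, k^o))) :
  exists g : X -> X, forall xi x, f xi x = xi (g x).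
Proof.
exists (fun x => \sum_(i < \dim {:X}) f (coordf i) x *: (vbasis {:X})`_i) => xi x.
rewrite {1}(functional_sum xi) !linear_sum sum_lfunE; apply: eq_bigr => i _.
by rewrite !linearZ scale_lfunE [RHS]mulrC.
Qed.

End LinearAlgebra.

Section DualBimodule.
Variables (k : closedFieldType) (L B : falgType k) (Q : rmod L).
Variables (theta : B -> {linear Q -> Q}).
Hypothesis thetaP : is_endomorphism_algebra theta.

Let th1 : forall s, theta 1 s = s. Proof. by case: thetaP. Qed.
Let thM : forall a b s, theta (a * b) s = theta a (theta b s).
Proof. by case: thetaP. Qed.
Let thD : forall c a b s, theta (c *: a + b) s = kscale c (theta a s) + theta b s.
Proof. by case: thetaP. Qed.
Let th_surj : forall f : {linear Q -> Q}, exists a, theta a =1 f.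
Proof. by case: thetaP. Qed.

(** D Q as a right module over B = End_L(Q). *)
Definition dual_endo : rmod B :=
  @dual_mod k B (kspace Q) (fun b q => theta b q)
    (fun q c a b => thD c a b q) (fun a => klinear_linear (theta a)) th1 thM.

Local Notation S := dual_endo.

Lemma dual_endoE (xi : 'Hom(kspace Q, k^o)) (b : B) q :
  ((b : B^c) *: (xi : S) : 'Hom(kspace Q, k^o)) q = xi (theta b q).
Proof. exact: dual_actE. Qed.

Fact dual_right_linear (a : L) :
  linear (fun xi : S => linfun ((xi : 'Hom(kspace Q, k^o)) \o linear_of (@act_linearl _ _ Q a)) : S).
Proof.
have DE (xi : 'Hom(kspace Q, k^o)) q :
    linfun (xi \o linear_of (@act_linearl _ _ Q a)) q = xi ((a : L^c) *: (q : Q)).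
  by rewrite lfunE.
move=> b xi zeta; apply/lfunP => q.
by rewrite DE !add_lfunE !dual_endoE !DE linearZ.
Qed.

Definition dual_right (a : L) : {linear S -> S} := linear_of (@dual_right_linear a).

Lemma dual_rightE a (xi : S) q :
  (dual_right a xi : 'Hom(kspace Q, k^o)) q = (xi : 'Hom(kspace Q, k^o)) ((a : L^c) *: (q : Q)).
Proof. exact: lfunE. Qed.

(** The hypotheses on q0 say that a |-> q0 a is injective with image q0 L, and
    that Q / q0 L is cogenerated by Q.  An endomorphism of D Q is the transpose of
    a map g : Q -> Q that commutes with all endomorphisms of Q.  Every
    endomorphism that kills q0 kills g q0, hence g q0 = q0 a for some a.  As Q is
    injective, each q is the image of q0 under an endomorphism u, and
    g q = g (u q0) = u (q0 a) = q a. *)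
Lemma double_centralizer (q0 : Q) : injective_mod Q ->
  (forall a : L, (a : L^c) *: q0 = 0 -> a = 0) ->
  (forall x, (forall d : {linear Q -> Q}, d q0 = 0 -> d x = 0) ->
    exists a : L, x = (a : L^c) *: q0) ->
  endomorphism_algebra L S.
Proof.
move=> Qi q0_free q0_sep; exists dual_right.
split=> [xi|a b xi|c a b xi|a b ab|f].
- by apply/lfunP => q; rewrite dual_rightE scale1r.
- by apply/lfunP => q; rewrite !dual_rightE scalerA.
- apply/lfunP => q; rewrite add_lfunE dual_rightE action_module_kscale scale_lfunE !dual_rightE.
  by rewrite act_linearr linearP.
- apply/eqP; rewrite -subr_eq0; apply/eqP/q0_free; rewrite scalerBl.
  apply: (@functional_sep k (kspace Q)) => xi; rewrite linearB.
  have := congr1 (fun z : 'Hom(kspace Q, k^o) => z q0) (ab xi).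
  by rewrite !dual_rightE => e; apply/eqP; rewrite subr_eq0; apply/eqP.
have f_lin : linear (f : 'Hom(kspace Q, k^o) -> 'Hom(kspace Q, k^o)).
  by move=> c xi zeta; rewrite linearD -action_module_kscale linear_kscale action_module_kscale.
have [g gE0] := transpose_exists (linfun (linear_of f_lin)).
have gE (xi : S) q : (f xi : 'Hom(kspace Q, k^o)) q = (xi : 'Hom(kspace Q, k^o)) (g q).
  by rewrite -gE0 lfunE.
have g_comm (u : {linear Q -> Q}) q : g (u q) = u (g q).
  have [b bE] := th_surj u.
  apply/eqP; rewrite -subr_eq0; apply/eqP; apply: (@functional_sep k (kspace Q)) => xi.
  have e : xi (g (u q)) = xi (u (g q)).
    transitivity ((f xi : 'Hom(kspace Q, k^o)) (u q)); first by rewrite gE.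
    transitivity ((f ((b : B^c) *: (xi : S)) : 'Hom(kspace Q, k^o)) q).
      by rewrite linearZ dual_endoE bE.
    by rewrite gE dual_endoE bE.
  by rewrite linearB; apply/eqP; rewrite subr_eq0; apply/eqP.
have [a aE] : exists a : L, g q0 = (a : L^c) *: q0.
  apply: q0_sep => d dq0; rewrite -g_comm dq0.
  have g0 := g_comm (\0 : {linear Q -> Q}) q0; exact: g0.
exists a => xi; apply/lfunP => q; rewrite dual_rightE gE; congr (xi _).
have [|u uE] := @injective_factor _ _ Q _ _ (orbit_map q0) (orbit_map q) Qi.
  by move=> b /q0_free ->; rewrite linear0.
have uq0 : u q0 = q by have := uE (1 : L); rewrite !orbit_map1.
by rewrite -uq0 g_comm aE linearZ.
Qed.

End DualBimodule.

(** * Modules over the endomorphism algebra as solutions of linear relations *)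

Section DualGenerates.
Variables (k : closedFieldType) (L B : falgType k) (Q : rmod L).
Variables (theta : B -> {linear Q -> Q}).
Hypothesis thetaP : is_endomorphism_algebra theta.
Hypotheses (Qi : injective_mod Q) (Qp : projective Q)
  (Q_cog : forall M : rmod L, cogenerated Q M -> pd_le M 1).

Let thM : forall a b s, theta (a * b) s = theta a (theta b s).
Proof. by case: thetaP. Qed.
Let thD : forall c a b s, theta (c *: a + b) s = kscale c (theta a s) + theta b s.
Proof. by case: thetaP. Qed.
Let th_inj : forall a b, theta a =1 theta b -> a = b.
Proof. by case: thetaP. Qed.
Let th_surj : forall f : {linear Q -> Q}, exists a, theta a =1 f.
Proof. by case: thetaP. Qed.

Let th_add a b s : theta (a + b) s = theta a s + theta b s.
Proof. by have := thD 1 a b s; rewrite /kscale !scale1r. Qed.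
Let th0 s : theta 0 s = 0.
Proof. by apply: (@addrI _ (theta 0 s)); rewrite -th_add !addr0. Qed.
Let th_sum I (r : seq I) (F : I -> B) s :
  theta (\sum_(i <- r) F i) s = \sum_(i <- r) theta (F i) s.
Proof. by elim/big_rec2: _ => [|i x y _ <-]; rewrite ?th0 ?th_add. Qed.

Variable X : rmod B.
Let n := \dim {:kspace X}.
Let V : vectType k := {ffun 'I_n -> B}.

(** All maps Q^n -> Q are of this form (row_map_full). *)
Definition row_map (b : V) : {linear power n Q -> Q} := power_cotuple (fun j => theta (b j)).

Lemma row_mapE b q : row_map b q = \sum_j theta (b j) (q j).
Proof. by []. Qed.

Lemma row_map_linear c b b' q :
  row_map (c *: b + b') q = kscale c (row_map b q) + row_map b' q.
Proof.
rewrite !row_mapE /kscale scaler_sumr -big_split; apply: eq_bigr => j _.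
by rewrite !ffunE thD.
Qed.

Lemma row_map_sum I (r : seq I) (F : I -> V) q :
  row_map (\sum_(l <- r) F l) q = \sum_(l <- r) row_map (F l) q.
Proof.
elim/big_rec2: _ => [|l x y _ <-].
  by rewrite row_mapE big1 // => j _; rewrite ffunE th0.
by have := row_map_linear 1 (F l) y q; rewrite scale1r /kscale !scale1r.
Qed.

Lemma row_map_inj b j s : row_map b (power_inj Q j s) = theta (b j) s.
Proof.
rewrite row_mapE (bigD1 j) //= ffunE eqxx big1 ?addr0 // => i ij.
by rewrite ffunE (negPf ij) linear0.
Qed.

Lemma row_map_full (f : {linear power n Q -> Q}) : exists b, row_map b =1 f.
Proof.
have [b bE] := choice (fun j => th_surj (f \o power_inj Q j : {linear Q -> Q})).
exists [ffun j => b j] => q; rewrite row_mapE {2}(power_sum q) linear_sum.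
by apply: eq_bigr => j _; rewrite ffunE bE.
Qed.

Lemma row_act_linear (b : V) :
  linear (fun x : kspace X => \sum_j coordf j ((b j : B^c) *: (x : X) : kspace X) : k^o).
Proof.
move=> c x y; rewrite scaler_sumr -big_split; apply: eq_bigr => j _.
by rewrite (act_linearl (b j)) linearP.
Qed.

(** With x_1, ..., x_n the coordinate functionals of X, row_act b is the element
    b_1 x_1 + ... + b_n x_n of the left B-module D X. *)
Definition row_act (b : V) : 'Hom(kspace X, k^o) := linfun (linear_of (row_act_linear b)).

Lemma row_actE (b : V) x : row_act b x = \sum_j coordf j ((b j : B^c) *: (x : X) : kspace X).
Proof. by rewrite lfunE. Qed.

Lemma row_act_lin : linear row_act.
Proof.
move=> c b b'; apply/lfunP => x; rewrite add_lfunE scale_lfunE !row_actE.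
rewrite scaler_sumr -big_split; apply: eq_bigr => j _.
by rewrite !ffunE (act_linearr x) linearP.
Qed.

Definition row_pairing : 'Hom(V, 'Hom(kspace X, k^o)) := linfun (linear_of row_act_lin).
Lemma row_pairingE b : row_pairing b = row_act b. Proof. exact: lfunE. Qed.

Lemma row_act_scale (a : B) (b : V) x :
  row_act ([ffun j => a * b j] : V) x = row_act b ((a : B^c) *: (x : X) : kspace X).
Proof.
rewrite !row_actE; apply: eq_bigr => j _; rewrite ffunE scalerA; reflexivity.
Qed.

Lemma row_act_sep x y : (forall b, row_act b x = row_act b y) -> x = y.
Proof.
move=> xy; rewrite (@coordf_sum k (kspace X) x) (@coordf_sum k (kspace X) y).
apply: eq_bigr => i _; congr (_ *: _).
have dE z : row_act ([ffun j => if j == i then 1 else 0] : V) z = coordf i z.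
  rewrite row_actE (bigD1 i) //= ffunE eqxx scale1r big1 ?addr0 // => j ji.
  rewrite ffunE (negPf ji) scale0r; exact: linear0.
by rewrite -!dE.
Qed.

(** The kernel of the presentation B^n -> D X. *)
Definition relation (b : V) : Prop := row_act b = 0.

Lemma solution_submodule :
  submodule (fun q : power n Q => forall b, relation b -> row_map b q = 0).
Proof.
split=> [b _|a q r q0 r0 b Rb]; first by rewrite linear0.
by rewrite linearP q0 // r0 // scaler0 addr0.
Qed.

(** P is the module of solutions in Q^n of all relations.  It turns out that
    D X = Hom_L(P, Q), the action of B^n on both being row_act and row_map. *)
Variables (P : rmod L) (i : {linear P -> power n Q}).
Hypotheses (i_inj : injective i)
  (iP : forall q, (forall b, relation b -> row_map b q = 0) <-> exists p, i p = q).

(** The quotient of Q^n by P is cogenerated by Q, by the very equations that define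
    P, so it has projective dimension at most 1. *)
Lemma solution_projective : projective P.
Proof.
have [C [p [p_surj p0]]] := quotmodP solution_submodule.
have C_cog : cogenerated Q C.
  move=> y; have [q <-] := p_surj y => q0; apply/p0 => b Rb.
  have [|u uE] := @factor_surj _ _ _ _ p (row_map b) p_surj.
    by move=> r /p0; apply.
  by rewrite -uE q0.
have ex : exact_at i p by move=> q; rewrite p0.
by apply: kernel_projective (Q_cog C_cog) _ p_surj i_inj ex; apply: in_add_projective Qp (power_in_add _ _).
Qed.

(** The converse of the definition of P.  Let beta : Q^n -> Q^m be given by a basis
    of the space of relations, so that P is its kernel.  A map b that
    vanishes on P factors through beta as Q is injective, which writes b as
    a B-linear combination of relations. *)
Lemma row_map_relation b : (forall p, row_map b (i p) = 0) -> relation b.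
Proof.
move=> bi.
have [|b1 b2 c Rb1 Rb2|U UP] := @vspace_of k V relation.
- by rewrite /relation -row_pairingE linear0.
- by rewrite /relation row_act_lin Rb1 Rb2 scaler0 addr0.
pose e := vbasis U; pose m := \dim U.
have Re l : relation e`_l.
  have [lt|ge] := ltnP l m; last by rewrite nth_default ?size_tuple // /relation -row_pairingE linear0.
  by apply/UP/vbasis_mem/mem_nth; rewrite size_tuple.
pose beta : {linear power n Q -> power m Q} := power_tuple (fun l => row_map e`_l).
have [|c cE] := @injective_factor _ _ Q _ _ beta (row_map b) Qi.
  move=> q bq0.
  have [p <-] : exists p, i p = q; last exact: bi.
  apply/iP => b' /UP/coord_vbasis ->.
  rewrite row_map_sum big1 // => l _.
  have := row_map_linear (coord e l b') e`_l 0 q.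
  rewrite addr0 => ->; have := congr1 (fun z : power m Q => z l) bq0.
  rewrite power_tupleE => ->; rewrite /kscale ffunE scaler0 add0r.
  by rewrite row_mapE big1 // => j _; rewrite ffunE th0.
have [a aE] := choice (fun l => th_surj (c \o power_inj Q l : {linear Q -> Q})).
have bE : b = [ffun j => \sum_(l < m) a l * e`_l j].
  apply/ffunP => j; apply: th_inj => s; rewrite ffunE th_sum -row_map_inj -cE.
  rewrite (power_sum (beta _)) linear_sum; apply: eq_bigr => l _.
  by rewrite thM aE comp_linE power_projE power_tupleE row_map_inj.
apply/lfunP => x; rewrite zero_lfunE bE row_actE.
transitivity (\sum_(l < m) row_act e`_l ((a l : B^c) *: (x : X) : kspace X)).
  under [RHS]eq_bigr do rewrite row_actE.
  rewrite exchange_big; apply: eq_bigr => j _; rewrite ffunE.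
  rewrite scaler_suml -linear_sum; congr (coordf j _).
  by apply: eq_bigr => l _; rewrite scalerA; reflexivity.
by rewrite big1 // => l _; rewrite Re zero_lfunE.
Qed.

(** Consequently the functional row_act b depends only on the map P -> Q that b
    induces. *)
Lemma row_act_eq b b' : (forall p, row_map b (i p) = row_map b' (i p)) ->
  row_act b = row_act b'.
Proof.
move=> bb'; have : relation (-1 *: b' + b).
  apply: row_map_relation => p; rewrite row_map_linear bb'.
  by rewrite /kscale scaleN1r -[in X in X *: _]/(- 1 : L) scaleNr !scale1r addrC subrr.
by rewrite /relation row_act_lin scaleN1r addrC => /eqP; rewrite subr_eq0 => /eqP.
Qed.

Lemma row_map_scale (a : B) (b : V) q :
  row_map [ffun j => a * b j] q = theta a (row_map b q).
Proof.
rewrite !row_mapE linear_sum; apply: eq_bigr => j _.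
by rewrite ffunE thM.
Qed.

Local Notation S := (dual_endo thetaP).
Local Notation fn xi := (xi : 'Hom(kspace Q, k^o)).

(** View X as D Hom_L(P, Q).  Composition with f : P -> L induces a map from
    Hom_L(L, Q) = Q to Hom_L(P, Q), and J is its dual.  A map P -> Q is handled
    through any b in B^n that extends it to Q^n. *)
Lemma coaction_exists (f : {linear P -> reg L}) : exists J : {linear X -> S},
  forall b q x, (forall p, row_map b (i p) = orbit_map q (f p)) ->
    fn (J x) q = row_act b x.
Proof.
have ext q : exists b, forall p, row_map b (i p) = orbit_map q (f p).
  have [c cE] := Qi (orbit_map q \o f : {linear P -> Q}) i_inj.
  by have [b bE] := row_map_full c; exists b => p; rewrite bE cE.
have [bq bqE] := choice ext.
have lin_q x : linear (fun q : kspace Q => row_act (bq q) x : k^o).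
  move=> c q r.
  rewrite (@row_act_eq (bq (c *: q + r)) (c *: bq q + bq r)) => [|p].
    by rewrite row_act_lin add_lfunE scale_lfunE.
  by rewrite row_map_linear !bqE !orbit_mapE act_linearl.
pose J (x : X) : S := linfun (linear_of (lin_q x)).
have JE x q : fn (J x) q = row_act (bq q) x by rewrite lfunE.
have lin : linear (J : X -> S).
  move=> a x y; apply/lfunP => q; rewrite add_lfunE dual_endoE !JE.
  have -> : row_act (bq q) (a *: x + y) = row_act (bq q) (a *: x : X) + row_act (bq q) y.
    exact: (linearD (row_act (bq q))).
  congr (_ + _); rewrite -row_act_scale.
  rewrite (@row_act_eq (bq (theta a q)) [ffun j => (a : B) * bq q j]) // => p.
  by rewrite row_map_scale !bqE !orbit_mapE linearZ.
exists (linear_of lin) => b q x bE; rewrite [LHS]JE.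
by rewrite (@row_act_eq (bq q) b) // => p; rewrite bqE bE.
Qed.

(** Dually to coaction_exists, evaluation at p is a map from Hom_L(P, Q) to Q,
    and T is its dual; its value at zeta is obtained by representing a
    functional on B^n that kills the relations. *)
Lemma action_exists (p : P) : exists T : {linear S -> X},
  forall b zeta, row_act b (T zeta) = fn zeta (row_map b (i p)).
Proof.
have lin_b (zeta : S) : linear (fun b : V => fn zeta (row_map b (i p)) : k^o).
  move=> c b b'; rewrite row_map_linear.
  exact: (linearP (fn zeta)).
have rep (zeta : S) : exists x, forall b, row_act b x = fn zeta (row_map b (i p)).
  have [|x xE] := @pairing_represents _ (kspace X) V row_pairing (linfun (linear_of (lin_b zeta))).
    move=> b; rewrite row_pairingE lfunE /= => Rb.
    have e : row_map b (i p) = 0 by apply: (proj2 (iP (i p))) => //; exists p.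
    exact: (etrans (congr1 (fun_of_lfun (fn zeta)) e) (linear0 _)).
  by exists x => b; rewrite -row_pairingE xE lfunE.
have [T TE] := choice rep.
have lin : linear (T : S -> X).
  move=> a zeta xi; apply: row_act_sep => b.
  have -> : row_act b (a *: T zeta + T xi) = row_act b (a *: T zeta : X) + row_act b (T xi).
    exact: (linearD (row_act b)).
  by rewrite -row_act_scale !TE row_map_scale add_lfunE dual_endoE.
by exists (linear_of lin) => b zeta; apply: TE.
Qed.

(** The maps of coaction_exists and action_exists, applied to a dual basis
    (f_l, t_l 1) of the projective module P, factor the identity of X through
    copies of S = D Q. *)
Lemma dual_generates_via_solutions : in_add S X.
Proof.
have /projectiveP[r [f [t tf]]] := solution_projective.
have [J JE] := choice (fun l => coaction_exists (f l)).
have [T TE] := choice (fun l => action_exists (t l (1 : L))).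
exists r, J, T => x; apply: row_act_sep => b.
have -> : row_act b (\sum_l T l (J l x)) = \sum_l row_act b (T l (J l x)).
  exact: (linear_sum (row_act b)).
have ext l : exists b', forall p,
    row_map b' (i p) = orbit_map (row_map b (i (t l (1 : L)))) (f l p).
  have [c cE] := Qi (orbit_map (row_map b (i (t l (1 : L)))) \o f l : {linear P -> Q}) i_inj.
  by have [b' b'E] := row_map_full c; exists b' => p; rewrite b'E cE.
have [b' b'E] := choice ext.
transitivity (\sum_l row_act (b' l) x); last first.
  by apply: eq_bigr => l _; rewrite TE (JE l (b' l)).
rewrite -sum_lfunE.
have <- : row_act (\sum_l b' l) = \sum_l row_act (b' l).
  rewrite -row_pairingE linear_sum; apply: eq_bigr => l _; exact: row_pairingE.
suff e : row_act b = row_act (\sum_l b' l) by rewrite e.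
apply: row_act_eq => p.
rewrite row_map_sum {1}(tf p) !linear_sum; apply: eq_bigr => l _.
by rewrite b'E (reg_mapE (t l)) orbit_mapE !linearZ.
Qed.

End DualGenerates.

Lemma dual_generates (k : closedFieldType) (L B : falgType k) (Q : rmod L)
    (theta : B -> {linear Q -> Q}) (thetaP : is_endomorphism_algebra theta) :
  injective_mod Q -> projective Q ->
  (forall M : rmod L, cogenerated Q M -> pd_le M 1) ->
  forall X : rmod B, in_add (dual_endo thetaP) X.
Proof.
move=> Qi Qp Q_cog X.
have [P [i [i_inj iP]]] := submodP (solution_submodule theta X).
exact: (dual_generates_via_solutions thetaP Qi Qp Q_cog i_inj iP).
Qed.

(** * From the torsion pair to an Auslander algebra *)

Section SummandSums.
Variables (k : closedFieldType) (L : falgType k).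
Variables (X : rmod L) (I : finType) (N : I -> rmod L).
Variables (j : forall i, {linear N i -> X}) (p : forall i, {linear X -> N i}).
Hypothesis jp : forall x, x = \sum_i j i (p i x).

Lemma sum_projective : (forall i, projective (N i)) -> projective X.
Proof.
move=> Np Y Z g f g_surj.
have h i := cid (Np i Y Z g (f \o j i : {linear N i -> Z}) g_surj).
exists (lin_sum (fun i => sval (h i) \o p i)) => x.
rewrite lin_sumE linear_sum {2}(jp x) linear_sum; apply: eq_bigr => i _.
exact: (svalP (h i)).
Qed.

Lemma sum_injective : (forall i, injective_mod (N i)) -> injective_mod X.
Proof.
move=> Ni Y Z g f g_inj.
have h i := cid (Ni i Y Z g (p i \o f : {linear Y -> N i}) g_inj).
exists (lin_sum (fun i => j i \o sval (h i))) => x.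
rewrite lin_sumE [RHS]jp; apply: eq_bigr => i _; rewrite comp_linE; congr (j i _).
exact: (svalP (h i)).
Qed.

End SummandSums.

Section TorsionToAuslander.
Variables (k : closedFieldType) (L : falgType k).
Variables (T F : rmod L -> Prop).
Hypotheses (TF : hereditary_torsion_pair T F)
  (FP : forall M : rmod L, pd_le M 1 <-> F M)
  (I_pd : forall I : rmod L, indecomposable I -> injective_mod I -> ~ pd_eq I 1).
Implicit Types M N P Q I U V W X Y Z K : rmod L.

Lemma torsionfree_sub M N (i : {linear N -> M}) : injective i -> F M -> F N.
Proof.
move=> i_inj FM; case: TF => [[_ _ TF0 _ Fmax] _]; apply: Fmax => X TX f x.
have /inj0P i0 := i_inj; apply: i0; exact: (TF0 X M TX FM (i \o f : {linear X -> M})).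
Qed.

Lemma torsionfree_cogenerated Q M : F Q -> cogenerated Q M -> F M.
Proof.
move=> FQ M_cog; case: TF => [[_ _ TF0 _ Fmax] _]; apply: Fmax => X TX f x.
by apply: M_cog => u; exact: (TF0 X Q TX FQ (u \o f : {linear X -> Q})).
Qed.

(** The image N of a map from a torsion module to the injective envelope of M is
    torsion; so is its intersection with M, as T is closed under submodules.
    This intersection is also torsion-free, hence zero, so N = 0 because M is
    essential. *)
Lemma torsionfree_hull M : F M ->
  exists I (i : {linear M -> I}), [/\ injective_mod I, injective i & F I].
Proof.
move=> FM; have [I [i [Ii i_inj i_ess]]] := injective_hull M.
exists I, i; split=> //; case: TF => [[_ _ TF0 Tmax Fmax] Tsub].
apply: Fmax => X TX f x.
have [N [n [n_inj nP]]] := submodP (image_submodule f).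
have [|f' f'E] := @factor_inj _ _ _ _ n f n_inj; first by move=> y; apply/nP; exists y.
have TN : T N.
  apply: Tmax => Y FY g y.
  have /nP[z nz] : exists z, n z = n y by exists y.
  have <- : f' z = y by apply: n_inj; rewrite f'E.
  exact: (TF0 X Y TX FY (g \o f' : {linear X -> Y})).
suff N0 : zero_mod N by rewrite -f'E (N0 (f' x)) linear0.
apply: (i_ess _ _ n_inj).
have sub : submodule (fun y : N => exists x, i x = n y).
  split=> [|a y z [u iu] [v iv]]; first by exists 0; rewrite !linear0.
  by exists (a *: u + v); rewrite !linearP iu iv.
have [K [ka [ka_inj kaP]]] := submodP sub.
have [|g gE] := @factor_inj _ _ _ _ i (n \o ka : {linear K -> I}) i_inj.
  by move=> y; apply/kaP; exists y.
have FK : F K.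
  apply: (@torsionfree_sub M K g _ FM).
  by move=> u v /(congr1 i); rewrite !gE => /n_inj/ka_inj.
have TK : T K by apply: Tsub ka_inj TN.
move=> u y iu; have /kaP[z <-] : exists x, i x = n y by exists u.
by rewrite (TF0 K K TK FK (idfun : {linear K -> K}) z : z = 0) !linear0.
Qed.

(** The indecomposable summands of I are injective of projective dimension at
    most 1, hence of projective dimension 0. *)
Lemma torsionfree_injective_projective I : injective_mod I -> F I -> projective I.
Proof.
move=> Ii FI; have [J [N [j [p [N_indec pj s]]]]] := indec_decomposition I.
apply: (sum_projective s) => i.
have N_inj : injective_mod (N i).
  by apply: in_add_injective Ii (retract_in_add _); exists (j i), (p i); apply: pj.
have pdN : pd_le (N i) 1.
  by apply/FP; apply: (@torsionfree_sub I (N i) (j i) _ FI); apply: can_inj (pj i).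
apply/pd_le0P; apply: contrapT => pd0; apply: (I_pd (N_indec i) N_inj).
by split=> // -[].
Qed.

Lemma torsionfree_embeds M : F M ->
  exists I (i : {linear M -> I}), [/\ injective_mod I, projective I, F I & injective i].
Proof.
move=> /torsionfree_hull[I [i [Ii i_inj FI]]]; exists I, i; split=> //.
exact: torsionfree_injective_projective.
Qed.

(** With L -> I0 -> I1 exact and Q = I0 + I1, the element q0 of Q is the image
    of 1. *)
Lemma Auslander_of_torsion_pair : Auslander_algebra L.
Proof.
have F_reg : F (reg L) by apply/FP/pd_le_projective/reg_projective.
have [I0 [i [I0i I0p FI0 i_inj]]] := torsionfree_embeds F_reg.
have [C [p [p_surj p0]]] := quotmodP (image_submodule i).
have FC : F C.
  apply/FP/pd_le1P; exists (reg L), I0, i, p; split=> //.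
  exact: reg_projective.
have [I1 [c [I1i I1p FI1 c_inj]]] := torsionfree_embeds FC.
pose Q : rmod L := FGMod (fg_pair (fgmodP I0) (fgmodP I1)).
have fst_lin : linear (fun q : Q => q.1) by [].
have snd_lin : linear (fun q : Q => q.2) by [].
have inl_lin : linear (fun x : I0 => (x, 0) : Q).
  by move=> a x y; apply: injective_projections; rewrite /= ?scaler0 ?addr0.
have inr_lin : linear (fun x : I1 => (0, x) : Q).
  by move=> a x y; apply: injective_projections; rewrite /= ?scaler0 ?addr0.
pose N (b : bool) := if b then I0 else I1.
pose jN b : {linear N b -> Q} :=
  if b return {linear N b -> Q} then linear_of inl_lin else linear_of inr_lin.
pose pN b : {linear Q -> N b} :=
  if b return {linear Q -> N b} then linear_of fst_lin else linear_of snd_lin.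
have sN q : q = \sum_b jN b (pN b q).
  rewrite big_bool; apply: injective_projections; rewrite /= ?addr0 ?add0r; reflexivity.
have Qi : injective_mod Q by apply: (sum_injective sN) => -[].
have Qp : projective Q by apply: (sum_projective sN) => -[].
have FQ : F Q by apply/FP/pd_le_projective.
pose q0 : Q := (i (1 : L), 0).
have q0_free (a : L) : (a : L^c) *: q0 = 0 -> a = 0.
  move=> /(congr1 (pN true)) e; have /inj0P i0 := i_inj; apply: i0.
  by rewrite reg_mapE; exact: e.
have Q_nz : ~ zero_mod Q.
  by move=> Q0; have /eqP := q0_free (1 : L) (Q0 _); rewrite oner_eq0.
(* The projection to I1 and the map I0 -> I1, both seen as endomorphisms of Q,
   kill q0, and their common kernel is q0 L. *)
have q0_sep x : (forall d : {linear Q -> Q}, d q0 = 0 -> d x = 0) ->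
    exists a : L, x = (a : L^c) *: q0.
  move=> x_sep.
  have x2 : x.2 = 0.
    have := x_sep (jN false \o pN false) (linear0 (jN false)).
    by move=> /(congr1 (pN false)); rewrite linear0.
  have cx : c (p x.1) = 0.
    have := x_sep (jN false \o c \o p \o pN true : {linear Q -> Q}).
    rewrite !comp_linE -[pN true q0]/(i (1 : L)).
    have -> : p (i (1 : L)) = 0 by apply/p0; exists (1 : L).
    by rewrite !linear0 => /(_ erefl)/(congr1 (pN false)); rewrite linear0.
  have /inj0P c0 := c_inj; have /p0[a ia] := c0 _ cx.
  exists a; apply: injective_projections.
    by rewrite -ia (reg_mapE i).
  by rewrite x2 -[RHS]/((a : L^c) *: (0 : I1)) scaler0.
apply: (Auslander_algebra_of_generator (double_centralizer (endo_algebraP Q_nz) Qi q0_free q0_sep)).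
apply: (dual_generates (endo_algebraP Q_nz) Qi Qp) => M M_cog.
exact/FP/(torsionfree_cogenerated FQ).
Qed.

End TorsionToAuslander.

Theorem theorem1p1 (k : closedFieldType) (Lambda : falgType k) :
  Auslander_algebra Lambda <->
  exists T F : rmod Lambda -> Prop,
    [/\ hereditary_torsion_pair T F,
        forall M : rmod Lambda, pd_le M 1 <-> F M
      & forall I : rmod Lambda,
          indecomposable I -> injective_mod I -> ~ pd_eq I 1].
Proof.
split=> [/generator_of_Auslander_algebra[B [S [[phi phiP] S_gen]]]|].
  exact: generator_torsion_pair phiP S_gen.
case=> T [F [TF FP I_pd]]; exact: Auslander_of_torsion_pair TF FP I_pd.
Qed.
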